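(* Let $\mathcal{S}$ be as in the context, let $A$ be a $C^*$-algebra, let $X=\{X(s)\}_{s\in\mathcal{S}}$ be a product system of $A$-correspondences over $\mathcal{S}$, and let $(\sigma,T)$ be a representation of $X$ on a Hilbert space $H$. Let $\hat T=\{\hat T_s\}_{s\in\mathcal{S}}$ be the contractive semigroup associated with $(\sigma,T)$, acting on $\mathcal{H}=H\oplus\big(\bigoplus_{0\ne s\in\mathcal{S}}X(s)\otimes_\sigma H\big)$, as defined in the context. Assume that $\hat T$ has a regular isometric dilation. Then there exist a Hilbert space $K\supseteq H$ and an isometric representation $V$ of $X$ on $K$ such that 1. $P_H$ commutes with $V_0(A)$, and $V_0(a)P_H=\sigma(a)P_H$ for all $a\in A$; 2. $P_{X(s_-)\otimes H}\,\tilde V_{s_-}^*\tilde V_{s_+}\big|_{X(s_+)\otimes H}=\tilde T_{s_-}^*\tilde T_{s_+}$ for all $s\in\mathcal{S}-\mathcal{S}$; 3. $K=\bigvee\{V(x)h: x\in X,\ h\in H\}$; 4. $P_HV_s(x)\big|_{K\ominus H}=0$ for all $s\in\mathcal{S}$, $x\in X(s)$. That is, if $\hat T$ has a regular isometric dilation, then so does $T$. If $\sigma$ is nondegenerate and $X$ is essential (that is, $AX(s)$ is dense in $X(s)$ for all $s\in\mathcal{S}$), then $V_0$ is also nondegenerate.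
   Context: $\mathbb{N}=\{0,1,2,\dots\}$. A semigroup $\Sigma$ (written additively) is commensurable if for all $s_1,\dots,s_N\in\Sigma$ there are $s_0\in\Sigma$ and $a_1,\dots,a_N\in\mathbb{N}$ with $s_i=a_is_0$ for all $i$. Throughout, $\Omega$ is a fixed set, for each $i\in\Omega$, $\mathcal{S}_i$ is a commensurable subsemigroup of $\mathbb{R}_+=[0,\infty)$ containing $0$, and $\mathcal{S}$ is the semigroup (under pointwise addition) of finitely supported functions $s:\Omega\to\mathbb{R}_+$ with $s(j)\in\mathcal{S}_j$ for all $j$. It is partially ordered by $s\le t$ iff $s(j)\le t(j)$ for all $j\in\Omega$ (and then $t-s\in\mathcal{S}$). $\mathcal{S}-\mathcal{S}$ is the subgroup of $\mathbb{R}^\Omega$ generated by $\mathcal{S}$; for $s\in\mathcal{S}-\mathcal{S}$, $s_+(j)=\max\{0,s(j)\}$ and $s_-=s_+-s$; both lie in $\mathcal{S}$. A (Hilbert) $C^*$-correspondence over $A$ is a right Hilbert $A$-module $E$ with a left action of $A$ by adjointable operators. The balanced tensor product $E\otimes F$ of correspondences is the Hausdorff completion of the algebraic tensor product in $\langle x\otimes y,w\otimes z\rangle=\langle y,\langle x,w\rangle\cdot z\rangle$, with $a\cdot(x\otimes y)=(a\cdot x)\otimes y$ and $(x\otimes y)a=x\otimes(ya)$. A product system $X$ over $\mathcal{S}$ is a family $\{X(s)\}_{s\in\mathcal{S}}$ of $C^*$-correspondences over $A$ whose disjoint union (also denoted $X$) is a semigroup with $X(s)X(t)\subseteq X(s+t)$,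 such that for $s,t\in\mathcal{S}\setminus\{0\}$ the map $(x,y)\mapsto xy$ extends to an isomorphism of correspondences $U_{s,t}:X(s)\otimes X(t)\to X(s+t)$, $X(0)=A$, and the multiplications $X(0)\times X(s)\to X(s)$, $X(s)\times X(0)\to X(s)$ are the left and right actions of $A$. A completely contractive covariant (c.c.) representation of a correspondence $E$ on a Hilbert space $H$ is a pair $(\sigma,T)$ with $T:E\to B(H)$ linear and completely contractive, $\sigma:A\to B(H)$ a nondegenerate $*$-homomorphism, and $T(xa)=T(x)\sigma(a)$, $T(a\cdot x)=\sigma(a)T(x)$ for $x\in E$, $a\in A$. $E\otimes_\sigma H$ is the Hausdorff completion of the algebraic tensor product in $\langle x\otimes h,y\otimes g\rangle=\langle h,\sigma(\langle x,y\rangle)g\rangle$, and $\tilde T:E\otimes_\sigma H\to H$ is the contraction $\tilde T(x\otimes h)=T(x)h$. It is isometric if $T(x)^*T(y)=\sigma(\langle x,y\rangle)$ for all $x,y\in E$. A representation $(\sigma,T)$ (or just $T$) of $X$ on $H$ is a map $T:X\to B(H)$ such that, with $T_s=T|_{X(s)}$ and $\sigma=T_0$, each $(\sigma,T_s)$ is a c.c. representation of $X(s)$ and $T(xy)=T(x)T(y)$ for all $x,y\in X$; it is isometric if every $(\sigma,T_s)$ is. $\tilde T_s$ denotes the contraction $X(s)\otimes_\sigma H\to H$ associated with $T_s$. For the representation $V$ on $K$, the same definitions apply with $V_0=V|_{X(0)}$ in the role of $\sigma$. Semigroups of operators. A contractive semigroup over $\mathcal{S}$ on a Hilbert space $G$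 is a family $R=\{R_s\}_{s\in\mathcal{S}}$ of contractions with $R_0=I$ and $R_sR_t=R_{s+t}$. A regular isometric dilation of $R$ is a semigroup $W=\{W_s\}_{s\in\mathcal{S}}$ of isometries on a Hilbert space $L\supseteq G$ with $P_GW_{s_-}^*W_{s_+}|_G=R_{s_-}^*R_{s_+}$ for all $s\in\mathcal{S}-\mathcal{S}$, where $P_G$ is the orthogonal projection of $L$ onto $G$. The semigroup $\hat T$. Write $\delta_s\cdot\xi$ for the element of $\mathcal{H}$ with $s$-th component $\xi$ (where $\xi\in X(s)\otimes_\sigma H$ if $s\ne0$, $\xi\in H$ if $s=0$) and other components $0$. Then $\hat T_0=I$ and for $0\ne s\in\mathcal{S}$, $t\in\mathcal{S}$: $\hat T_s(\delta_t\cdot\xi)=0$ if $t\ngeq s$; $\hat T_s(\delta_s\cdot\xi)=\delta_0\cdot\tilde T_s\xi$; and $\hat T_s(\delta_t\cdot(U_{t-s,s}(x_{t-s}\otimes x_s)\otimes h))=\delta_{t-s}\cdot(x_{t-s}\otimes\tilde T_s(x_s\otimes h))$ if $t\ge s$, $t\ne s$, for $x_{t-s}\in X(t-s)$, $x_s\in X(s)$, $h\in H$. This is a contractive semigroup. Regular isometric dilation of a representation. An isometric representation $(\rho,V)$ of $X$ on $K\supseteq H$ is a regular isometric dilation of $(\sigma,T)$ if for all $a\in A$, $H$ reduces $\rho(a)$ and $\rho(a)|_H=\sigma(a)$, and for all $s\in\mathcal{S}-\mathcal{S}$, $P_{X(s_-)\otimes H}\tilde V_{s_-}^*\tilde V_{s_+}|_{X(s_+)\otimes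 H}=\tilde T_{s_-}^*\tilde T_{s_+}$. Here $P_{X(s_-)\otimes H}$ is the orthogonal projection of $X(s_-)\otimes_\rho K$ onto $X(s_-)\otimes_\rho H$, and $X(s)\otimes_\rho H$ is identified with $X(s)\otimes_\sigma H$. $P_H$ is the orthogonal projection of $K$ onto $H$, and $\bigvee$ denotes closed linear span.
   Formalization: Nondegeneracy of V_0 is not part of ''isometric representation V'' here (it fails in general, e.g. when X(1) has zero left action); it is asserted only when X is essential, as in the last sentence. σ is assumed nondegenerate throughout. *)

(* Defs.v *)
From HB Require Import structures.
From mathcomp Require Import all_boot all_order all_algebra.
From mathcomp Require Import all_classical all_reals all_analysis.
From mathcomp Require Import complex.

Set Implicit Arguments.
Unset Strict Implicit.
Unset Printing Implicit Defensive.
Import Order.TTheory GRing.Theory Num.Theory.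
Import numFieldNormedType.Exports.
Local Open Scope classical_set_scope.
Local Open Scope ring_scope.
Local Open Scope complex_scope.

Definition commensurable (R : realType) (Sigma : R -> Prop) :=
  forall (N : nat) (s : 'I_N -> R), (forall i, Sigma (s i)) ->
  exists2 s0, Sigma s0 & exists a : 'I_N -> nat, forall i, s i = s0 *+ a i.

Record commSubsemigroup (R : realType) := CommSubsemigroup {
  cs_set :> R -> Prop;
  cs_ge0 : forall x, cs_set x -> 0 <= x;
  cs_0 : cs_set 0;
  cs_add : forall x y, cs_set x -> cs_set y -> cs_set (x + y);
  cs_comm : commensurable cs_set }.

Record fsupp (R : realType) (Omega : Type) (Sg : Omega -> commSubsemigroup R) :=
  FSupp {
    fs_fun :> Omega -> R;
    fs_fin : finite_set [set j | fs_fun j != 0];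
    fs_in : forall j, Sg j (fs_fun j) }.

Section FSupp.
Variables (R : realType) (Omega : Type) (Sg : Omega -> commSubsemigroup R).
Local Notation S := (fsupp Sg).

Lemma fsupp_ext (s t : S) : (forall j, s j = t j) -> s = t.
Proof.
case: s t => [f ff fi] [g gf gi] /= /funext fg.
by subst g; rewrite (Prop_irrelevance ff gf) (Prop_irrelevance fi gi).
Qed.

HB.instance Definition _ := gen_eqMixin (fsupp Sg).
HB.instance Definition _ := gen_choiceMixin (fsupp Sg).

Lemma fsupp0_fin : finite_set [set j : Omega | (0 : R) != 0].
Proof. by rewrite [X in finite_set X](_ : _ = set0) // -subset0 => j /=; rewrite eqxx. Qed.

Definition fsupp0 : S := FSupp fsupp0_fin (fun j => cs_0 (Sg j)).

Lemma fsupp_add_fin (s t : S) : finite_set [set j | s j + t j != 0].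
Proof.
apply: (@sub_finite_set _ _ ([set j | s j != 0] `|` [set j | t j != 0])).
  move=> j /=; have [-> /=|] := eqVneq (s j) 0; last by left.
  by rewrite add0r; right.
by rewrite finite_setU; split; exact: fs_fin.
Qed.

Definition fsupp_add (s t : S) : S :=
  FSupp (fsupp_add_fin s t) (fun j => cs_add (fs_in s j) (fs_in t j)).

Lemma fsupp_addA : associative fsupp_add.
Proof. by move=> s t u; apply: fsupp_ext => j /=; rewrite addrA. Qed.

Lemma fsupp_addC : commutative fsupp_add.
Proof. by move=> s t; apply: fsupp_ext => j /=; rewrite addrC. Qed.

Lemma fsupp_add0 : left_id fsupp0 fsupp_add.
Proof. by move=> s; apply: fsupp_ext => j /=; rewrite add0r. Qed.

HB.instance Definition _ :=
  GRing.isNmodule.Build (fsupp Sg) fsupp_addA fsupp_addC fsupp_add0.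

Definition fs_le (s t : S) := forall j, s j <= t j.

Definition in_diff (s : Omega -> R) :=
  exists u v : S, forall j, s j = u j - v j.

Lemma cs_sub_pos (i : Omega) (x y : R) :
  Sg i x -> Sg i y -> Sg i (Num.max 0 (x - y)).
Proof.
move=> Sx Sy.
have [z Sz [a axy]] := @cs_comm _ (Sg i) 2
  (fun k : 'I_2 => if k == ord0 then x else y)
  (fun k => match k == ord0 as b return Sg i (if b then x else y) with
            | true => Sx | false => Sy end).
have -> : x = z *+ a ord0 by rewrite -axy.
have -> : y = z *+ a (lift ord0 ord0) by rewrite -axy.
have z0 := cs_ge0 Sz.
have Szn n : Sg i (z *+ n).
  by elim: n => [|n IH]; [exact: cs_0 | rewrite mulrS; exact: cs_add].
have [ab|ba] := leqP (a (lift ord0 ord0)) (a ord0).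
  by rewrite -mulrnBr // max_r // mulrn_wge0.
rewrite max_l; first exact: cs_0.
by rewrite subr_le0 ler_wpMn2l // ltnW.
Qed.

Lemma in_diff_pos_fin (s : Omega -> R) : in_diff s ->
  finite_set [set j | Num.max 0 (s j) != 0].
Proof.
move=> [u [v suv]]; apply: (sub_finite_set _ (fsupp_add_fin u v)) => j /=.
apply: contraNN => /eqP uv0.
have u0 := cs_ge0 (fs_in u j); have v0 := cs_ge0 (fs_in v j).
have /andP[/eqP uj /eqP vj] : (u j == 0) && (v j == 0).
  by rewrite -paddr_eq0 // uv0.
by rewrite suv uj vj subrr maxxx.
Qed.

Lemma in_diff_pos_in (s : Omega -> R) : in_diff s ->
  forall j, Sg j (Num.max 0 (s j)).
Proof.
by move=> [u [v suv]] j; rewrite suv; apply: cs_sub_pos; exact: fs_in.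
Qed.

Definition pos_part (s : Omega -> R) (hs : in_diff s) : S :=
  FSupp (in_diff_pos_fin hs) (in_diff_pos_in hs).

Lemma max_sub (x : R) : Num.max 0 x - x = Num.max 0 (- x).
Proof.
by rewrite -[X in _ + X]opprK opprK addr_maxl sub0r subrr maxC.
Qed.

Lemma in_diff_neg_fin (s : Omega -> R) : in_diff s ->
  finite_set [set j | Num.max 0 (s j) - s j != 0].
Proof.
move=> [u [v suv]].
have h : in_diff (fun j => - s j) by exists v, u => j; rewrite suv opprB.
apply: (sub_finite_set _ (in_diff_pos_fin h)) => j /=.
by rewrite max_sub.
Qed.

Lemma in_diff_neg_in (s : Omega -> R) : in_diff s ->
  forall j, Sg j (Num.max 0 (s j) - s j).
Proof.
move=> [u [v suv]] j; rewrite max_sub suv opprB.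
by apply: cs_sub_pos; exact: fs_in.
Qed.

Definition neg_part (s : Omega -> R) (hs : in_diff s) : S :=
  FSupp (in_diff_neg_fin hs) (in_diff_neg_in hs).

End FSupp.

Definition closed_span (K : numFieldType) (V : normedModType K) (B : set V) :
    set V :=
  closure [set v | exists (n : nat) (c : 'I_n -> K) (b : 'I_n -> V),
    (forall i, B (b i)) /\ v = \sum_i c i *: b i].

HB.mixin Record CompleteNormedModule_isHilbert (R : realType) H
    of CompleteNormedModule R[i] H := {
  hip : H -> H -> R[i];
  hip_linear : forall x (c : R[i]) y z, hip x (c *: y + z) = c * hip x y + hip x z;
  hip_conj : forall x y, hip y x = (hip x y)^*;
  hip_norm : forall x, hip x x = `|x| ^+ 2 }.

#[short(type="hilbertType")]
HB.structure Definition Hilbert (R : realType) :=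
  {H of CompleteNormedModule R[i] H & CompleteNormedModule_isHilbert R H}.

Section Operators.
Variable R : realType.
Implicit Types H G : hilbertType R.

Definition bounded_op H G (f : H -> G) := linear f /\ continuous f.

Definition contraction_op H G (f : H -> G) :=
  linear f /\ forall x, `|f x| <= `|x|.

Definition lin_isometry H G (f : H -> G) :=
  linear f /\ forall x, `|f x| = `|x|.

Definition is_adjoint H G (f : H -> G) (g : G -> H) :=
  forall x y, hip (f x) y = hip x (g y).

(* The adjoint; a bounded operator has exactly one, so the default value 0 is
   never used for such operators. *)
Definition adj H G (f : H -> G) : G -> H :=
  xget (fun=> 0) [set g | is_adjoint f g].

(* Inclusions H <= K are linear isometries j : H -> K; oproj j is the
   orthogonal projection of K onto j(H). *)
Definition oproj H G (j : H -> G) : G -> G := j \o adj j.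

Definition reduces H G (j : H -> G) (f : G -> G) :=
  (forall h, range j (f (j h))) /\ (forall h, range j (adj f (j h))).

(* (hs_space, hs_inj) is the Hilbert direct sum of the family G. *)
Record hilbertSum (I : Type) (G : I -> hilbertType R) := HilbertSum {
  hs_space :> hilbertType R;
  hs_inj : forall i, G i -> hs_space;
  hs_isom : forall i, lin_isometry (@hs_inj i);
  hs_orth : forall i k (x : G i) (y : G k), i <> k ->
    hip (hs_inj x) (hs_inj y) = 0;
  hs_dense : closed_span [set z | exists i x, z = @hs_inj i x] = setT }.

End Operators.

(* C*-algebras are not assumed to be unital. *)
HB.mixin Record CompleteNormedModule_isCStarAlg (R : realType) A
    of CompleteNormedModule R[i] A := {
  amul : A -> A -> A;
  astar : A -> A;
  amulA : forall a b c, amul a (amul b c) = amul (amul a b) c;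
  amul_linearl : forall b (c : R[i]) x y,
    amul (c *: x + y) b = c *: amul x b + amul y b;
  amul_linearr : forall a (c : R[i]) x y,
    amul a (c *: x + y) = c *: amul a x + amul a y;
  amul_norm : forall a b, `|amul a b| <= `|a| * `|b|;
  astarK : forall a, astar (astar a) = a;
  astar_semilinear : forall (c : R[i]) x y,
    astar (c *: x + y) = c^* *: astar x + astar y;
  astarM : forall a b, astar (amul a b) = amul (astar b) (astar a);
  astar_norm : forall a, `|amul (astar a) a| = `|a| ^+ 2 }.

#[short(type="cstarAlgType")]
HB.structure Definition CStarAlg (R : realType) :=
  {A of CompleteNormedModule R[i] A & CompleteNormedModule_isCStarAlg R A}.

Definition apositive (R : realType) (A : cstarAlgType R) (a : A) :=
  exists b : A, a = amul (astar b) b.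

(* A left action by adjointable operators: clact is a *-homomorphism into the
   adjointable operators, i.e. clact (astar a) is the adjoint of clact a. *)
HB.mixin Record CompleteNormedModule_isCorr (R : realType) (A : cstarAlgType R) E
    of CompleteNormedModule R[i] E := {
  cract : E -> A -> E;
  cract_linearl : forall a (c : R[i]) x y,
    cract (c *: x + y) a = c *: cract x a + cract y a;
  cract_linearr : forall x (c : R[i]) a b,
    cract x (c *: a + b) = c *: cract x a + cract x b;
  cractA : forall x a b, cract (cract x a) b = cract x (amul a b);
  ip : E -> E -> A;
  ip_linear : forall x (c : R[i]) y z, ip x (c *: y + z) = c *: ip x y + ip x z;
  ip_ract : forall x y a, ip x (cract y a) = amul (ip x y) a;
  ip_star : forall x y, astar (ip x y) = ip y x;
  ip_pos : forall x, apositive (ip x x);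
  ip_norm : forall x, `|ip x x| = `|x| ^+ 2;
  clact : A -> E -> E;
  clact_linearl : forall x (c : R[i]) a b,
    clact (c *: a + b) x = c *: clact a x + clact b x;
  clact_linearr : forall a (c : R[i]) x y,
    clact a (c *: x + y) = c *: clact a x + clact a y;
  clactA : forall a b x, clact (amul a b) x = clact a (clact b x);
  clact_adj : forall a x y, ip (clact a x) y = ip x (clact (astar a) y) }.

#[short(type="corrType")]
HB.structure Definition Corr (R : realType) (A : cstarAlgType R) :=
  {E of CompleteNormedModule R[i] E & CompleteNormedModule_isCorr R A E}.

Section Correspondences.
Variables (R : realType) (A : cstarAlgType R).
Implicit Types E F Z : corrType A.

Definition corr_iso E F (U : E -> F) :=
  [/\ linear U, bijective U,
      forall x y : E, ip (U x) (U y) = ip x y,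
      forall a (x : E), U (clact a x) = clact a (U x)
    & forall (x : E) a, U (cract x a) = cract (U x) a].

(* (Z, ten) is the Hausdorff completion of the algebraic tensor product. *)
Definition balanced_tensor E F Z (ten : E -> F -> Z) :=
  [/\ (forall x, linear (ten x)) /\ (forall y, linear (ten^~ y)),
      forall x y w z, ip (ten x y) (ten w z) = ip y (clact (ip x w) z),
      forall a x y, clact a (ten x y) = ten (clact a x) y,
      forall x y a, cract (ten x y) a = ten x (cract y a)
    & closed_span [set v | exists x y, v = ten x y] = setT].

(* (it_space, ten) is the Hausdorff completion E (x)_sigma H. *)
Record interiorTensor E (H : hilbertType R) (sigma : A -> H -> H) :=
  InteriorTensor {
    it_space :> hilbertType R;
    ten : E -> H -> it_space;
    ten_linearl : forall h, linear (ten^~ h);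
    ten_linearr : forall x, linear (ten x);
    ten_ip : forall x y h g, hip (ten x h) (ten y g) = hip h (sigma (ip x y) g);
    ten_dense : closed_span [set v | exists x h, v = ten x h] = setT }.

Definition star_hom (H : hilbertType R) (sigma : A -> H -> H) :=
  [/\ forall a, bounded_op (sigma a),
      forall (c : R[i]) a b h, sigma (c *: a + b) h = c *: sigma a h + sigma b h,
      forall a b h, sigma (amul a b) h = sigma a (sigma b h)
    & forall a, is_adjoint (sigma a) (sigma (astar a))].

Definition nondegenerate_rep (H : hilbertType R) (sigma : A -> H -> H) :=
  closed_span [set v | exists a h, v = sigma a h] = setT.

Definition mx_amul n (M N : 'M[A]_n) : 'M[A]_n :=
  \matrix_(i, j) \sum_k amul (M i k) (N k j).

Definition mx_astar n (M : 'M[A]_n) : 'M[A]_n := \matrix_(i, j) astar (M j i).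

(* The C*-algebra B is M_n(A), via phi; so the norm of a matrix M is
   `|phi M|.  The C*-norm on M_n(A) exists and is unique. *)
Definition is_matrix_algebra n (B : cstarAlgType R) (phi : 'M[A]_n -> B) :=
  [/\ bijective phi,
      forall (c : R[i]) M N,
        phi (map_mx (fun a => c *: a) M + N) = c *: phi M + phi N,
      forall M N, phi (mx_amul M N) = amul (phi M) (phi N)
    & forall M, phi (mx_astar M) = astar (phi M)].

(* The M_n(A)-valued inner square of x in M_n(E). *)
Definition mx_ip E n (x : 'M[E]_n) : 'M[A]_n :=
  \matrix_(i, j) \sum_k ip (x k i) (x k j).

(* M_n(E) carries the norm of a Hilbert M_n(A)-module,
   ||x||^2 = ||<x,x>||_{M_n(A)}; the condition says that
   ||(T x_ij)||_{B(H^n)} <= ||x||_{M_n(E)} for all n and all x. *)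
Definition completely_contractive E (H : hilbertType R) (T : E -> H -> H) :=
  forall n (B : cstarAlgType R) (phi : 'M[A]_n -> B), is_matrix_algebra phi ->
  forall (x : 'M[E]_n) (h : 'I_n -> H),
    \sum_i `|\sum_j T (x i j) (h j)| ^+ 2
      <= `|phi (mx_ip x)| * \sum_j `|h j| ^+ 2.

(* Nondegeneracy of sigma is not included here; it is a separate condition. *)
Definition cc_representation E (H : hilbertType R) (sigma : A -> H -> H)
    (T : E -> H -> H) :=
  [/\ star_hom sigma,
      (forall x, bounded_op (T x)) /\
        (forall (c : R[i]) x y h, T (c *: x + y) h = c *: T x h + T y h),
      completely_contractive T,
      forall x a h, T (cract x a) h = T x (sigma a h)
    & forall a x h, T (clact a x) h = sigma a (T x h)].

Definition isometric E (H : hilbertType R) (sigma : A -> H -> H)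
    (T : E -> H -> H) :=
  forall x y h, adj (T x) (T y h) = sigma (ip x y) h.

Definition is_tilde E (H : hilbertType R) (sigma : A -> H -> H)
    (T : E -> H -> H) (Y : interiorTensor E sigma) (Tt : Y -> H) :=
  contraction_op Tt /\ forall x h, Tt (ten Y x h) = T x h.

End Correspondences.

(* The identification X(0) = A is the isomorphism of correspondences ps_unit; the
   last three fields are equalities in the disjoint union of the X(s). *)
Record productSystem (R : realType) (Omega : Type)
    (Sg : Omega -> commSubsemigroup R) (A : cstarAlgType R) := ProductSystem {
  ps :> fsupp Sg -> corrType A;
  ps_mul : forall s t, ps s -> ps t -> ps (s + t);
  ps_unit : A -> ps 0;
  ps_unit_linear : linear ps_unit;
  ps_unit_bij : bijective ps_unit;
  ps_unit_ip : forall a b, ip (ps_unit a) (ps_unit b) = amul (astar a) b;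
  ps_unit_lact : forall a b, clact a (ps_unit b) = ps_unit (amul a b);
  ps_unit_ract : forall a b, cract (ps_unit a) b = ps_unit (amul a b);
  ps_iso : forall s t, s != 0 -> t != 0 ->
    exists (Z : corrType A) (ten : ps s -> ps t -> Z) (U : Z -> ps (s + t)),
      [/\ balanced_tensor ten, corr_iso U
        & forall x y, U (ten x y) = ps_mul x y];
  ps_mulA : forall s t u (x : ps s) (y : ps t) (z : ps u),
    existT (fun r => ps r : Type) _ (ps_mul (ps_mul x y) z) =
    existT (fun r => ps r : Type) _ (ps_mul x (ps_mul y z));
  ps_mul0l : forall s a (x : ps s),
    existT (fun r => ps r : Type) _ (ps_mul (ps_unit a) x) =
    existT (fun r => ps r : Type) _ (clact a x);
  ps_mul0r : forall s (x : ps s) a,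
    existT (fun r => ps r : Type) _ (ps_mul x (ps_unit a)) =
    existT (fun r => ps r : Type) _ (cract x a) }.

Section ProductSystems.
Variables (R : realType) (Omega : Type) (Sg : Omega -> commSubsemigroup R).
Variables (A : cstarAlgType R) (X : productSystem Sg A).
Local Notation S := (fsupp Sg).

Definition essential :=
  forall s, closed_span [set v : X s | exists a x, v = clact a x] = setT.

Definition rep0 (H : hilbertType R) (T : forall s, X s -> H -> H) : A -> H -> H :=
  fun a => T 0 (ps_unit X a).

Definition is_representation (H : hilbertType R)
    (T : forall s, X s -> H -> H) :=
  (forall s, cc_representation (rep0 T) (T s)) /\
  forall s t (x : X s) (y : X t) h, T _ (ps_mul x y) h = T s x (T t y h).

Definition is_isometric_representation (H : hilbertType R)
    (T : forall s, X s -> H -> H) :=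
  is_representation T /\ forall s, isometric (rep0 T) (T s).

Definition contractive_semigroup (G : hilbertType R) (W : S -> G -> G) :=
  [/\ forall s, contraction_op (W s), forall g, W 0 g = g
    & forall s t g, W s (W t g) = W (s + t) g].

Definition regular_isometric_dilation (G : hilbertType R) (P : S -> G -> G)
    (L : hilbertType R) (j : G -> L) (W : S -> L -> L) :=
  [/\ lin_isometry j,
      forall s, lin_isometry (W s),
      (forall l, W 0 l = l) /\ (forall s t l, W s (W t l) = W (s + t) l)
    & forall (s : Omega -> R) (hs : in_diff Sg s) g,
        oproj j (adj (W (neg_part hs)) (W (pos_part hs) (j g))) =
        j (adj (P (neg_part hs)) (P (pos_part hs) g))].

Section Hat.
Variables (H : hilbertType R) (T : forall s, X s -> H -> H).
Arguments T : clear implicits.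
Variable Y : forall s, interiorTensor (X s) (rep0 T).
Variable Tt : forall s, Y s -> H.
Arguments Tt : clear implicits.

Definition hat_component (i : option {s : S | s != 0}) : hilbertType R :=
  if i is Some u then Y (sval u) else H.

Variable Hh : hilbertSum hat_component.

Definition delta0 (h : H) : Hh := @hs_inj _ _ _ Hh None h.

Definition delta (s : S) (hs : s != 0) (xi : Y s) : Hh :=
  @hs_inj _ _ _ Hh (Some (exist (fun s => s != 0) s hs)) xi.

(* In the last clause t = r + s, i.e. r = t - s, and U_{r,s}(x (x) y) = xy. *)
Definition is_hat_semigroup (That : S -> Hh -> Hh) :=
  contractive_semigroup That /\
  forall s (hs : s != 0),
  [/\ forall h, That s (delta0 h) = 0,
      forall t (ht : t != 0) xi, ~ fs_le s t -> That s (delta ht xi) = 0,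
      forall xi, That s (delta hs xi) = delta0 (Tt s xi)
    & forall r (hr : r != 0) (hrs : r + s != 0) (x : X r) (y : X s) h,
        That s (delta hrs (ten (Y (r + s)) (ps_mul x y) h)) =
        delta hr (ten (Y r) x (Tt s (ten (Y s) y h)))].

Variables (K : hilbertType R) (j : H -> K) (V : forall s, X s -> K -> K).
Arguments V : clear implicits.

(* J s is the identification of X(s) (x)_sigma H with the subspace
   X(s) (x)_rho H of X(s) (x)_rho K. *)
Definition regularity :=
  exists (YK : forall s, interiorTensor (X s) (rep0 V))
         (Vt : forall s, YK s -> K) (J : forall s, Y s -> YK s),
  [/\ forall s, is_tilde (V s) (Vt s),
      forall s, lin_isometry (J s) /\
        (forall x h, J s (ten (Y s) x h) = ten (YK s) x (j h))
    & forall (s : Omega -> R) (hs : in_diff Sg s) (xi : Y (pos_part hs)),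
        oproj (J (neg_part hs))
          (adj (Vt (neg_part hs)) (Vt (pos_part hs) (J (pos_part hs) xi))) =
        J (neg_part hs) (adj (Tt (neg_part hs)) (Tt (pos_part hs) xi))].

Definition rep_regular_isometric_dilation :=
  [/\ lin_isometry j, is_isometric_representation V,
      forall a, reduces j (rep0 V a) /\ (forall h, rep0 V a (j h) = j (rep0 T a h))
    & regularity].

End Hat.
End ProductSystems.

(* Main.v *)
From HB Require Import structures.
Require Import Defs.
From mathcomp Require Import all_boot all_order all_algebra.
From mathcomp Require Import all_classical all_reals all_analysis.
From mathcomp Require Import complex ring lra.
Set Implicit Arguments.
Unset Strict Implicit.
Unset Printing Implicit Defensive.
Import Order.TTheory GRing.Theory Num.Theory.
Import numFieldNormedType.Exports.
Local Open Scope classical_set_scope.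
Local Open Scope complex_scope.
Local Open Scope ring_scope.

(* The dilation space [K] is cut out of the space [L] of a regular isometric
   dilation [W] of the semigroup [That] on the Fock space [Hh]: it is the closed
   span of the vectors [g(t, y, h) = W_t (delta_t . (y (x) h))], and
   [V_s x g(t, y, h) = g(s + t, x y, h)].  With [m] the pointwise minimum of [s]
   and [t], regularity gives
     [<g(s, y, h), g(t, z, h')>
        = <That_(s-m) delta_s.(y (x) h), That_(t-m) delta_t.(z (x) h')>],
   and both vectors on the right lie in the component of index [m], since
   [That_(s-m) (delta_s . (p q (x) h)) = delta_m . (p (x) T(q) h)] for [p] in
   [X(m)] and [q] in [X(s-m)].  Left multiplication by [x] acts on the factor [p]
   alone, so that [<g(u+s, x y, h), g(u+t, x' z, h')> = <g(s, y, h),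
   g(t, <x, x'> z, h')>], which makes [V] well defined and isometric.

   All norm estimates come from one fact about C*-algebras: a functional [phi]
   that is positive on the unitization with value [N] at the unit satisfies
   [phi c <= |c| N] for self-adjoint [c]. *)

(** * Closed linear spans and bounded linear maps *)

Section Spans.
Variables (K : numFieldType) (V : normedModType K).

(** The finite sums of [closed_span] in inductive form, so that facts about the span follow by
    induction on a combination. *)
Inductive lin_span (B : set V) : V -> Prop :=
| lin_span0 : lin_span B 0
| lin_spanD c b v : B b -> lin_span B v -> lin_span B (c *: b + v).

Lemma lin_spanP (B : set V) v :
  (exists (n : nat) (c : 'I_n -> K) (b : 'I_n -> V),
    (forall i, B (b i)) /\ v = \sum_i c i *: b i) <-> lin_span B v.
Proof.
split.
  case=> n; elim: n v => [|n IH] v [c [b [Bb ->]]].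
    by rewrite big_ord0; exact: lin_span0.
  rewrite big_ord_recl; apply: lin_spanD => //.
  by apply: IH; exists (c \o lift ord0), (b \o lift ord0); split=> // i; exact: Bb.
elim=> [|c b {}v Bb _ [n [c' [b' [Bb' ->]]]]].
  by exists 0%N, (fun=> 0), (fun=> 0); split; [case | rewrite big_ord0].
exists n.+1, (fun i => oapp c' c (unlift ord0 i)),
  (fun i => oapp b' b (unlift ord0 i)); split.
  by move=> i; case: unliftP => [j _|_] /=.
rewrite big_ord_recl unlift_none /=; congr (_ + _).
by apply: eq_bigr => i _; rewrite liftK.
Qed.

Lemma lin_span_lin (B : set V) c v w :
  lin_span B v -> lin_span B w -> lin_span B (c *: v + w).
Proof.
move=> + Bw; elim=> [|d b {}v Bb _ IH]; first by rewrite scaler0 add0r.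
by rewrite scalerDr scalerA -addrA; exact: lin_spanD.
Qed.

Lemma lin_span_mem (B : set V) b : B b -> lin_span B b.
Proof.
by move=> Bb; rewrite -[b]scale1r -[_ *: _]addr0; apply: lin_spanD => //; left.
Qed.

Lemma closureP (A : set V) v :
  closure A v <-> forall e, 0 < e -> exists2 w, A w & `|v - w| < e.
Proof.
split=> [cA e e0|cA U].
  have [w [Aw vw]] := cA _ (nbhsx_ballx v e e0).
  by exists w => //; move: vw; rewrite -ball_normE.
move=> /nbhs_ballP[e /= e0 eU].
have [w Aw vw] := cA _ e0; exists w; split=> //; apply: eU.
by rewrite -ball_normE.
Qed.

Lemma closed_spanP (B : set V) v : closed_span B v <->
  forall e, 0 < e -> exists2 w, lin_span B w & `|v - w| < e.
Proof.
by rewrite /closed_span closureP; split=> h e /h[w /lin_spanP Bw vw]; exists w.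
Qed.

Lemma closed_span_mem (B : set V) b : B b -> closed_span B b.
Proof.
by move=> Bb; apply/closed_spanP => e e0; exists b;
  [exact: lin_span_mem | rewrite subrr normr0].
Qed.

Lemma closed_span0 (B : set V) : closed_span B 0.
Proof.
by apply/closed_spanP => e e0; exists 0; [left | rewrite subrr normr0].
Qed.

Lemma closed_span_approx (B : set V) v :
  (forall e, 0 < e -> exists2 w, closed_span B w & `|v - w| < e) ->
  closed_span B v.
Proof.
move=> h; apply/closed_spanP => e e0.
have e20 : 0 < e / 2 by rewrite divr_gt0.
have [w /closed_spanP/(_ _ e20)[u Bu wu] vw] := h _ e20.
exists u => //; rewrite -[v](subrK w) -addrA (splitr e).
by rewrite (le_lt_trans (ler_normD _ _))// ltrD.
Qed.

Lemma closed_span_lin (B : set V) c v w :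
  closed_span B v -> closed_span B w -> closed_span B (c *: v + w).
Proof.
move=> /closed_spanP hv /closed_spanP hw; apply/closed_spanP => e e0.
have e20 : 0 < e / 2 by rewrite divr_gt0.
have c0 : 0 < `|c| + 1 by rewrite ltr_wpDl.
have [v' Bv' vv'] := hv _ (divr_gt0 e20 c0).
have [w' Bw' ww'] := hw _ e20.
exists (c *: v' + w'); first exact: lin_span_lin.
rewrite opprD addrACA -scalerBr (splitr e) (le_lt_trans (ler_normD _ _))//.
rewrite ler_ltD// normrZ.
apply: (@le_trans _ _ ((`|c| + 1) * `|v - v'|)).
  by rewrite ler_wpM2r// lerDl.
by rewrite mulrC -ler_pdivlMr// ltW.
Qed.

(** The last premise says that [P] is a closed set, the two before it that [P] is a subspace
    containing [B]. *)
Lemma closed_span_ind (B : set V) (P : V -> Prop) :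
    P 0 -> (forall b, B b -> P b) ->
    (forall c v w, P v -> P w -> P (c *: v + w)) ->
    (forall v, (forall e, 0 < e -> exists2 w, P w & `|v - w| < e) -> P v) ->
  forall v, closed_span B v -> P v.
Proof.
move=> P0 PB PD Pc v /closed_spanP hv; apply: Pc => e /hv[w Bw vw]; exists w => //.
by elim: Bw => // c b u /PB Pb _; exact: PD.
Qed.

Lemma closed_spanS (B B' : set V) :
  B `<=` closed_span B' -> closed_span B `<=` closed_span B'.
Proof.
move=> BB'; apply: closed_span_ind => //; first exact: closed_span0.
  by move=> *; exact: closed_span_lin.
exact: closed_span_approx.
Qed.

Lemma closed_span_total (B B' : set V) :
  closed_span B = setT -> B `<=` closed_span B' -> closed_span B' = setT.
Proof.
by move=> BT BB'; rewrite -subTset -BT; exact: closed_spanS.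
Qed.

End Spans.

Section BoundedLinear.
Variable K : numFieldType.
Implicit Types V W : normedModType K.

(** An explicit bound [M] replaces the continuity of [bounded_op], so that density arguments become
    estimates. *)
Definition bounded_linear V W (f : V -> W) :=
  linear f /\ exists2 M, 0 <= M & forall x, `|f x| <= M * `|x|.

Lemma linear_fun0 (U V : lmodType K) (f : U -> V) : linear f -> f 0 = 0.
Proof. by move=> fl; have := fl (-1) 0 0; rewrite scaler0 addr0 scaleN1r addNr. Qed.

Lemma linear_funD (U V : lmodType K) (f : U -> V) x y :
  linear f -> f (x + y) = f x + f y.
Proof. by move=> fl; have := fl 1 x y; rewrite !scale1r. Qed.

Lemma linear_funZ (U V : lmodType K) (f : U -> V) c x :
  linear f -> f (c *: x) = c *: f x.
Proof. by move=> fl; have := fl c x 0; rewrite (linear_fun0 fl) !addr0. Qed.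

Lemma linear_funB (U V : lmodType K) (f : U -> V) x y :
  linear f -> f (x - y) = f x - f y.
Proof. by move=> fl; rewrite -scaleN1r addrC fl scaleN1r addrC. Qed.

Lemma linear_fun_sum (U V : lmodType K) (f : U -> V) (I : Type) (r : seq I)
    (F : I -> U) : linear f -> f (\sum_(i <- r) F i) = \sum_(i <- r) f (F i).
Proof.
move=> fl; elim: r => [|i r IH]; first by rewrite !big_nil (linear_fun0 fl).
by rewrite !big_cons (linear_funD _ _ fl) IH.
Qed.

Lemma continuous_of_bounded_linear V W (f : V -> W) :
  bounded_linear f -> continuous f.
Proof.
move=> [fl [M M0 fM]] x; apply/cvgrPdist_lt => e e0.
have M1 : 0 < M + 1 by rewrite ltr_wpDl.
near=> y; rewrite -(linear_funB _ _ fl) (le_lt_trans (fM _))//.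
apply: (@le_lt_trans _ _ ((M + 1) * `|x - y|)); first by rewrite ler_wpM2r// lerDl.
rewrite mulrC -ltr_pdivlMr//; near: y.
by apply: (@cvgr_dist_lt _ _ _ _ _ id x) => //; rewrite divr_gt0.
Unshelve. all: by end_near. Qed.

Lemma bounded_linear_comp (U V W : normedModType K) (f : U -> V) (g : V -> W) :
  bounded_linear f -> bounded_linear g -> bounded_linear (g \o f).
Proof.
move=> [fl [M M0 fM]] [gl [N N0 gN]]; split=> [c x y /=|].
  by rewrite fl gl.
exists (N * M); first by rewrite mulr_ge0.
by move=> x /=; rewrite (le_trans (gN _))// -mulrA ler_wpM2l.
Qed.

Lemma bounded_linear_lin V W (f g : V -> W) c :
  bounded_linear f -> bounded_linear g -> bounded_linear (fun x => c *: f x + g x).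
Proof.
move=> [fl [M M0 fM]] [gl [N N0 gN]]; split=> [d x y|].
  by rewrite fl gl !scalerDr !scalerA mulrC addrACA.
exists (`|c| * M + N); first by rewrite addr_ge0// mulr_ge0.
move=> x; rewrite (le_trans (ler_normD _ _))// mulrDl lerD// normrZ -mulrA.
by rewrite ler_wpM2l.
Qed.

Lemma bounded_linear_eq V W (B : set V) (f g : V -> W) :
  bounded_linear f -> bounded_linear g -> closed_span B = setT ->
  (forall b, B b -> f b = g b) -> f =1 g.
Proof.
move=> [fl [M M0 fM]] [gl [N N0 gN]] BT fg.
suff fgB v : closed_span B v -> f v = g v by move=> v; apply: fgB; rewrite BT.
apply: (@closed_span_ind _ _ B (fun v => f v = g v)) => // {v}.
  by rewrite (linear_fun0 fl) (linear_fun0 gl).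
  by move=> c v w fv fw; rewrite fl gl fv fw.
move=> v hv; apply/eqP; rewrite -subr_eq0 -normr_le0; apply/ler_addgt0Pl => e e0.
have MN : 0 < M + N + 1 by rewrite ltr_wpDl// addr_ge0.
have [w fgw vw] := hv _ (divr_gt0 e0 MN).
have -> : f v - g v = f (v - w) + g (w - v).
  by rewrite (linear_funB _ _ fl) (linear_funB _ _ gl) fgw addrA subrK.
rewrite addr0 (le_trans (ler_normD _ _))// (le_trans (lerD (fM _) (gN _)))//.
rewrite [`|w - v|]distrC -mulrDl.
apply: (@le_trans _ _ ((M + N + 1) * `|v - w|)); first by rewrite ler_wpM2r// lerDl.
by rewrite mulrC -ler_pdivlMr// ltW.
Qed.

End BoundedLinear.

(** * Hilbert spaces and adjoints *)

Section Hip.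
Variable R : realType.
Implicit Types H G : hilbertType R.

Lemma hip_lin H (x : H) : linear (hip x : H -> R[i]^o).
Proof. by move=> c y z; rewrite hip_linear. Qed.

Lemma hip0r H (x : H) : hip x 0 = 0.
Proof. exact: linear_fun0 (hip_lin x). Qed.

Lemma hipDr H (x y z : H) : hip x (y + z) = hip x y + hip x z.
Proof. exact: linear_funD (hip_lin x). Qed.

Lemma hipBr H (x y z : H) : hip x (y - z) = hip x y - hip x z.
Proof. exact: linear_funB (hip_lin x). Qed.

Lemma hipZr H (x y : H) c : hip x (c *: y) = c * hip x y.
Proof. exact: linear_funZ (hip_lin x). Qed.

Lemma hip_sumr H (x : H) (I : Type) (r : seq I) (F : I -> H) :
  hip x (\sum_(i <- r) F i) = \sum_(i <- r) hip x (F i).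
Proof. exact: linear_fun_sum (hip_lin x). Qed.

Lemma hipC H (x y : H) : hip y x = (hip x y)^*.
Proof. exact: hip_conj. Qed.

Lemma hip0l H (x : H) : hip 0 x = 0.
Proof. by rewrite hipC hip0r conjC0. Qed.

Lemma hipDl H (x y z : H) : hip (y + z) x = hip y x + hip z x.
Proof. by rewrite hipC hipDr rmorphD/= -!hipC. Qed.

Lemma hipZl H (x y : H) c : hip (c *: y) x = c^* * hip y x.
Proof. by rewrite hipC hipZr rmorphM/= -hipC. Qed.

Lemma hipNl H (x y : H) : hip (- y) x = - hip y x.
Proof. by rewrite -scaleN1r hipZl rmorphN/= rmorph1 mulN1r. Qed.

Lemma hipBl H (x y z : H) : hip (y - z) x = hip y x - hip z x.
Proof. by rewrite hipDl hipNl. Qed.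

Lemma hip_suml H (x : H) (I : Type) (r : seq I) (F : I -> H) :
  hip (\sum_(i <- r) F i) x = \sum_(i <- r) hip (F i) x.
Proof.
by rewrite hipC hip_sumr rmorph_sum/=; apply: eq_bigr => i _; rewrite -hipC.
Qed.

Lemma hip_ge0 H (x : H) : 0 <= hip x x.
Proof. by rewrite hip_norm exprn_ge0. Qed.

Lemma hip_eq0 H (x : H) : hip x x = 0 -> x = 0.
Proof.
by rewrite hip_norm => /eqP; rewrite sqrf_eq0 normr_eq0 => /eqP.
Qed.

Lemma hip_ext H (x y : H) : (forall z, hip z x = hip z y) -> x = y.
Proof.
by move=> xy; apply/eqP; rewrite -subr_eq0; apply/eqP/hip_eq0; rewrite hipBr xy subrr.
Qed.

Lemma hip_cauchy_schwarz H (x y : H) : `|hip x y| <= `|x| * `|y|.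
Proof.
have [->|x0] := eqVneq x 0; first by rewrite hip0l !normr0 mul0r.
have hx : 0 < `|x| ^+ 2 by rewrite exprn_gt0// normr_gt0.
rewrite -(@ler_pXn2r _ 2) ?nnegrE ?mulr_ge0// exprMn -(ler_pM2l hx).
(* The square of this vector is [|x|^2 (|x|^2 |y|^2 - |<x,y>|^2)]. *)
have := hip_ge0 (`|x| ^+ 2 *: y - hip x y *: x).
rewrite hipBl !hipBr !hipZl !hipZr [hip y x]hipC !hip_norm normCK.
have -> : (`|x| ^+ 2)^* = `|x| ^+ 2 by rewrite -hip_norm -hipC.
set a := `|x| ^+ 2; set b := `|y| ^+ 2; set c := hip x y => h.
rewrite -subr_ge0; move: h.
by congr (0 <= _); ring.
Qed.

Lemma hip_bounded_linear H (x : H) : bounded_linear (hip x : H -> R[i]^o).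
Proof.
split; first exact: hip_lin.
by exists `|x| => // y; exact: hip_cauchy_schwarz.
Qed.

Lemma parallelogram H (x y : H) :
  `|x + y| ^+ 2 + `|x - y| ^+ 2 = 2 * (`|x| ^+ 2 + `|y| ^+ 2).
Proof. by rewrite -!hip_norm hipBl !hipDl !hipBr !hipDr; ring. Qed.

(** Polarization: norms determine [<x,y> + <y,x>], and replacing [y] by ['i *: y] gives
    [<x,y> - <y,x>] as well. *)
Lemma lin_isometry_hip H G (f : H -> G) : lin_isometry f ->
  forall x y, hip (f x) (f y) = hip x y.
Proof.
move=> [fl fi] x y.
have D u v : hip (f u) (f v) + hip (f v) (f u) = hip u v + hip v u.
  have := hip_norm (f (u + v)); rewrite fi -hip_norm (linear_funD _ _ fl).
  rewrite !hipDl !hipDr !hip_norm !fi => /eqP.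
  by rewrite -!addrA (inj_eq (addrI _)) !addrA (inj_eq (addIr _)) => /eqP.
have := D x ('i *: y); rewrite (linear_funZ _ _ fl) !hipZl !hipZr.
rewrite conjCi !mulNr -!mulrBr => /(mulfI _) D2.
have {}D2 := D2 (neq0Ci _); have D1 := D x y.
apply: (@mulfI _ (2 : R[i])); first by rewrite pnatr_eq0.
transitivity ((hip (f x) (f y) + hip (f y) (f x)) + (hip (f x) (f y) - hip (f y) (f x))).
  by ring.
by rewrite D1 D2; ring.
Qed.

Lemma hip_lin_isometry H G (f : H -> G) : linear f ->
  (forall x y, hip (f x) (f y) = hip x y) -> lin_isometry f.
Proof.
move=> fl fh; split=> // x; apply/eqP; rewrite -(@eqrXn2 _ 2)//.
by rewrite -!hip_norm fh.
Qed.

Lemma lin_isometry_bounded H G (f : H -> G) :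
  lin_isometry f -> bounded_linear f.
Proof. by move=> [fl fi]; split=> //; exists 1 => // x; rewrite fi mul1r. Qed.

Lemma contraction_bounded H G (f : H -> G) :
  contraction_op f -> bounded_linear f.
Proof. by move=> [fl fi]; split=> //; exists 1 => // x; rewrite mul1r. Qed.

Lemma lin_isometry_inj H G (f : H -> G) : lin_isometry f -> injective f.
Proof.
move=> [fl fi] x y fxy; apply/eqP; rewrite -subr_eq0 -normr_eq0 -fi.
by rewrite (linear_funB _ _ fl) fxy subrr normr0.
Qed.

End Hip.

(** * Completeness and the Riesz representation theorem *)

Section Completeness.
Variable R : realType.

Lemma small_invS (e : R[i]) : 0 < e -> exists n : nat, n.+1%:R^-1 < e.
Proof.
move=> e0; have er : e \is Num.real by rewrite gtr0_real.
rewrite -(RRe_real er) in e0 *; rewrite ltcR in e0.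
have [n ne] : exists n : nat, (n.+1%:R^-1 : R) < complex.Re e.
  exists (Num.trunc (complex.Re e)^-1).
  by rewrite invf_plt ?posrE// truncnS_gt.
exists n; suff -> : (n.+1%:R^-1 : R[i]) = (n.+1%:R^-1)%:C by rewrite ltcR.
by rewrite fmorphV/= rmorph_nat.
Qed.

Lemma cauchy_seq_cvg (V : completeNormedModType R[i]) (u : nat -> V) :
  (forall e, 0 < e ->
    exists N, forall n m, (N <= n)%N -> (N <= m)%N -> `|u n - u m| < e) ->
  exists l, forall e, 0 < e -> exists N, forall n, (N <= n)%N -> `|l - u n| < e.
Proof.
move=> hu; have : cvg (u @ \oo).
  apply/cauchy_cvgP/cauchy_ballP => e e0; near_simpl.
  have [N hN] := hu e e0.
  near=> p; rewrite -ball_normE /ball_/=; apply: hN.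
    by near: p; exists ([set n | (N <= n)%N], [set n | (N <= n)%N]);
      [split; exists N | case=> a b [] ].
  by near: p; exists ([set n | (N <= n)%N], [set n | (N <= n)%N]);
      [split; exists N | case=> a b [] ].
move=> /cvgrPdist_lt cu; exists (lim (u @ \oo)) => e /cu [N _ hN].
by exists N => n Nn; exact: hN.
Unshelve. all: by end_near. Qed.

End Completeness.

Section Riesz.
Variables (R : realType) (H : hilbertType R).

(** Norms live in [R[i]]; the real part brings them to [R], where infima exist. *)
Let rn (x : H) : R := complex.Re `|x|.

Let rnE x : (rn x)%:C = `|x|.
Proof. by rewrite RRe_real// normr_real. Qed.

Let rn_ge0 x : 0 <= rn x.
Proof. by rewrite -lecR rnE normr_ge0. Qed.

(** The representing vector is a multiple of the point [z] of least norm on the hyperplane [f = 1].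
    A minimizing sequence is Cauchy by the parallelogram law, and minimality makes [z] orthogonal to
    the kernel of [f]. *)
Lemma riesz (f : H -> R[i]^o) : bounded_linear f ->
  exists z, forall x, f x = hip z x.
Proof.
move=> [fl [M M0 fM]].
have [[x0 fx0]|f0] := pselect (exists x, f x != 0); last first.
  exists 0 => x; rewrite hip0l; apply/eqP/negPn/negP => fx; apply: f0.
  by exists x.
pose A : set R := [set rn x | x in [set x | f x = 1]].
have A0 : has_inf A.
  split; last by exists 0 => _ [x _ <-].
  exists (rn ((f x0)^-1 *: x0)), ((f x0)^-1 *: x0) => //=.
  by rewrite (linear_funZ _ _ fl); exact: mulVf.
pose d := inf A.
have dle x : f x = 1 -> d <= rn x.
  by move=> fx; apply: (ge_inf A0.2); exists x.
have d0 : 0 <= d by apply: lb_le_inf; [exact: A0.1 | move=> _ [x _ <-]].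
have /choice [u hu] : forall n : nat, exists x, f x = 1 /\ rn x < d + n.+1%:R^-1.
  move=> n; have n0 : 0 < n.+1%:R^-1 :> R by rewrite invr_gt0 ltr0Sn.
  have [_ [x fx <-] xd] := inf_adherent n0 A0.
  by exists x.
(* The midpoint of [u n] and [u m] has norm at least [d], so the parallelogram law bounds the square
   by [4 (d + e)^2 - 4 d^2 = 8 d e + 4 e^2], and [e <= 1] absorbs the second power. *)
have dist n m (e : R) : 0 < e -> e <= 1 -> n.+1%:R^-1 <= e -> m.+1%:R^-1 <= e ->
    rn (u n - u m) ^+ 2 <= (8 * d + 4) * e.
  move=> e0 e1 ne me.
  have [fn un] := hu n; have [fm um] := hu m.
  have mid : 4 * d ^+ 2 <= rn (u n + u m) ^+ 2.
    have : d <= rn (2^-1 *: (u n + u m)).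
      apply: dle; rewrite (linear_funZ _ _ fl) (linear_funD _ _ fl) fn fm.
      by rewrite -[1 + 1]/(2%:R) /GRing.scale/= mulVf// pnatr_eq0.
    have -> : rn (2^-1 *: (u n + u m)) = 2^-1 * rn (u n + u m).
      apply: complexI; rewrite rmorphM/= !rnE normrZ gtr0_norm ?invr_gt0//.
      by rewrite fmorphV/= rmorph_nat.
    by have := rn_ge0 (u n + u m); nra.
  have : rn (u n + u m) ^+ 2 + rn (u n - u m) ^+ 2 =
      2 * (rn (u n) ^+ 2 + rn (u m) ^+ 2).
    apply: complexI; rewrite mulr_natl mulr2n !rmorphD !rmorphXn /= !rnE.
    by rewrite parallelogram mulr_natl mulr2n.
  have := rn_ge0 (u n); have := rn_ge0 (u m).
  have un' : rn (u n) <= d + e by rewrite ltW// (lt_le_trans un)// lerD2l.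
  have um' : rn (u m) <= d + e by rewrite ltW// (lt_le_trans um)// lerD2l.
  by nra.
have [z hz] : exists l, forall e : R[i], 0 < e ->
    exists N, forall n, (N <= n)%N -> `|l - u n| < e.
  apply: cauchy_seq_cvg => e e0.
  have er : e \is Num.real by rewrite gtr0_real.
  rewrite -(RRe_real er) in e0 *; rewrite ltcR in e0; move: (complex.Re e) e0 => {er}e e0.
  (* At most [1] as [dist] requires, and small enough that [(8 * d + 4) * e' < e ^+ 2]. *)
  pose e' := Num.min 1 (e ^+ 2 / (8 * d + 4) / 2).
  have d4 : 0 < 8 * d + 4 by lra.
  have e'0 : 0 < e' by rewrite lt_min ltr01/= !divr_gt0// exprn_gt0.
  have [N hN] : exists N : nat, (N.+1%:R^-1 : R) < e'.
    by exists (Num.trunc e'^-1); rewrite invf_plt ?posrE// truncnS_gt.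
  have small n : (N <= n)%N -> (n.+1%:R^-1 : R) <= e'.
    move=> Nn; apply: le_trans (ltW hN).
    by rewrite lef_pV2 ?posrE ?ltr0Sn// ler_nat.
  exists N => n m Nn Nm; rewrite -rnE ltcR -(@ltr_pXn2r _ 2) ?nnegrE ?rn_ge0 ?(ltW e0)//.
  have := dist n m e' e'0 _ (small _ Nn) (small _ Nm).
  have -> : e' <= 1 by rewrite ge_min lexx.
  move=> /(_ isT) /le_lt_trans; apply.
  have e'le : e' <= e ^+ 2 / (8 * d + 4) / 2 by rewrite ge_min lexx orbT.
  have q0 : 0 < e ^+ 2 / (8 * d + 4) by rewrite divr_gt0// exprn_gt0.
  have : e' < e ^+ 2 / (8 * d + 4) by lra.
  by rewrite ltr_pdivlMr// mulrC.
have fz : f z = 1.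
  apply/eqP; rewrite -subr_eq0 -normr_le0; apply/ler_addgt0Pl => e e0; rewrite addr0.
  have M1 : 0 < M + 1 by rewrite ltr_wpDl.
  have [N /(_ _ (leqnn _)) hN] := hz _ (divr_gt0 e0 M1).
  rewrite -(hu N).1 -(linear_funB _ _ fl) (le_trans (fM _))//.
  apply: (@le_trans _ _ ((M + 1) * `|z - u N|)); first by rewrite ler_wpM2r// lerDl.
  by rewrite mulrC -ler_pdivlMr// ltW.
have zd : rn z <= d.
  apply/ler_addgt0Pl => e e0.
  have e20 : 0 < (e / 2)%:C :> R[i] by rewrite ltcR divr_gt0.
  have [N hN] := hz _ e20.
  have [n hn] : exists n : nat, (n.+1%:R^-1 : R) < e / 2.
    by exists (Num.trunc (e / 2)^-1); rewrite invf_plt ?posrE ?divr_gt0// truncnS_gt.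
  have h1 := hN (maxn N n) (leq_maxl _ _).
  have [_ h2] := hu (maxn N n).
  have h3 : ((maxn N n).+1%:R^-1 : R) <= n.+1%:R^-1.
    by rewrite lef_pV2 ?posrE ?ltr0Sn// ler_nat ltnS leq_maxr.
  have : rn z <= rn (z - u (maxn N n)) + rn (u (maxn N n)).
    by rewrite -lecR rmorphD/= !rnE -{1}[z](subrK (u (maxn N n))) ler_normD.
  move: h1 h2 h3 hn; rewrite -rnE ltcR.
  by move: ((maxn N n).+1%:R^-1 : R) (n.+1%:R^-1 : R) => p q; lra.
(* Removing from [z] its component along [y] stays on the hyperplane and lowers the squared norm by
   [|<y,z>|^2 / |y|^2]. *)
have orth y : f y = 0 -> hip y z = 0.
  move=> fy; have [->|y0] := eqVneq y 0; first by rewrite hip0l.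
  have N0 : 0 < `|y| ^+ 2 by rewrite exprn_gt0// normr_gt0.
  have le1 : `|z| <= `|z - (hip y z / `|y| ^+ 2) *: y|.
    rewrite -!rnE lecR (le_trans zd)// dle// (linear_funB _ _ fl) (linear_funZ _ _ fl).
    by rewrite fz fy scaler0 subr0.
  have le2 : `|z| ^+ 2 <= `|z - (hip y z / `|y| ^+ 2) *: y| ^+ 2.
    by rewrite ler_pXn2r ?nnegrE.
  move: le2; rewrite -!hip_norm hipBl !hipBr !hipZl !hipZr [hip z y]hipC !hip_norm.
  rewrite rmorphM/= fmorphV/=.
  have -> : (`|y| ^+ 2)^* = `|y| ^+ 2 by rewrite -hip_norm -hipC.
  rewrite -subr_ge0; set a := hip y z; set N := `|y| ^+ 2.
  set t := (X in 0 <= X); have -> : t = - (`|a| ^+ 2 / N).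
    rewrite /t normCK; field.
    by rewrite gt_eqF.
  rewrite oppr_ge0 pmulr_lle0 ?invr_gt0// => h.
  by apply/eqP; rewrite -normr_eq0 -sqrf_eq0 eq_le h exprn_ge0.
have z0 : z != 0.
  by apply/eqP => zE; move: fz; rewrite zE (linear_fun0 fl) => /esym/eqP; rewrite oner_eq0.
have Nz : `|z| ^+ 2 != 0 by rewrite sqrf_eq0 normr_eq0.
exists ((`|z| ^+ 2)^-1 *: z) => x.
have := orth (x - f x *: z).
rewrite (linear_funB _ _ fl) (linear_funZ _ _ fl) fz /GRing.scale/= mulr1 subrr.
move=> /(_ erefl); rewrite hipC => /eqP; rewrite conjC_eq0 hipBr hipZr subr_eq0.
rewrite hip_norm => /eqP hzx; rewrite hipZl hzx fmorphV/=.
have -> : (`|z| ^+ 2)^* = `|z| ^+ 2 by rewrite -hip_norm -hipC.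
by rewrite mulrCA mulVf// mulr1.
Qed.

End Riesz.

Section Adjoint.
Variable R : realType.
Implicit Types H G : hilbertType R.

(** Riesz supplies an adjoint, so [adj] does not fall back on its default value. *)
Lemma is_adjoint_ex H G (f : H -> G) : bounded_linear f -> is_adjoint f (adj f).
Proof.
move=> bf; have /choice [g hg] : forall y : G, exists z, forall x, hip y (f x) = hip z x.
  move=> y; apply: (riesz (f := fun x => hip y (f x))).
  exact: bounded_linear_comp bf (hip_bounded_linear y).
apply: (@xgetPex _ (fun=> 0) [set g | is_adjoint f g]).
by exists g => x y; rewrite hipC hg -hipC.
Qed.

Lemma adj_uniq H G (f : H -> G) g : is_adjoint f g -> adj f = g.
Proof.
move=> fg; apply/funext => y; apply: hip_ext => x; rewrite -fg.
have := @xgetPex _ (fun=> 0) [set g | is_adjoint f g] (ex_intro _ g fg).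
by move=> ->.
Qed.

Lemma hip_adjr H G (f : H -> G) x y : bounded_linear f ->
  hip x (adj f y) = hip (f x) y.
Proof. by move=> /is_adjoint_ex ->. Qed.

Lemma adj_linear H G (f : H -> G) : bounded_linear f -> linear (adj f).
Proof.
move=> bf c x y; apply: hip_ext => z.
by rewrite hip_linear !hip_adjr// hip_linear.
Qed.

Lemma adj_contraction H G (f : H -> G) : contraction_op f -> contraction_op (adj f).
Proof.
move=> cf; have bf := contraction_bounded cf; split; first exact: adj_linear.
move=> x; have [->|y0] := eqVneq (adj f x) 0; first by rewrite normr0.
rewrite -(@ler_pM2l _ `|adj f x|) ?normr_gt0// -expr2 -hip_norm hip_adjr//.
rewrite -[leLHS]ger0_norm; last by rewrite -hip_adjr// hip_ge0.
by rewrite (le_trans (hip_cauchy_schwarz _ _))// ler_wpM2r// cf.2.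
Qed.

End Adjoint.

(** * Inner product identities checked on total sets *)

Section Totality.
Variables (R : realType) (V : normedModType R[i]) (B : set V).
Hypothesis BT : closed_span B = setT.
Variables (W W' : hilbertType R) (f : V -> W) (g : V -> W').
Hypotheses (bf : bounded_linear f) (bg : bounded_linear g).

Lemma hip_eq_total_r w w' :
  (forall b, B b -> hip w (f b) = hip w' (g b)) ->
  forall v, hip w (f v) = hip w' (g v).
Proof.
apply: (@bounded_linear_eq _ V _ B (fun v => hip w (f v) : R[i]^o)
          (fun v => hip w' (g v) : R[i]^o)) => //.
- exact: bounded_linear_comp (hip_bounded_linear _).
- exact: bounded_linear_comp (hip_bounded_linear _).
Qed.

Lemma hip_eq_total_l w w' :
  (forall b, B b -> hip (f b) w = hip (g b) w') ->
  forall v, hip (f v) w = hip (g v) w'.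
Proof.
move=> h v; rewrite hipC [RHS]hipC; congr (_^*); move: v.
by apply: hip_eq_total_r => b Bb; rewrite hipC h // -hipC.
Qed.

End Totality.

Lemma bounded_linear_id (R : realType) (V : normedModType R[i]) :
  bounded_linear (@id V).
Proof. by split=> //; exists 1 => // x; rewrite mul1r. Qed.

(** * Positive functionals on C*-algebras *)

Section CStar.
Variables (R : realType) (A : cstarAlgType R).
Implicit Types a b c : A.

Lemma amulDl a b c : amul (a + b) c = amul a c + amul b c.
Proof. exact: (linear_funD (f := amul^~ c)) (amul_linearl c). Qed.

Lemma amulDr a b c : amul a (b + c) = amul a b + amul a c.
Proof. exact: linear_funD (amul_linearr a). Qed.

Lemma amulNl a b : amul (- a) b = - amul a b.
Proof.
by rewrite -sub0r (linear_funB (f := amul^~ b)) ?(linear_fun0 (amul_linearl b))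
  ?sub0r//; exact: amul_linearl.
Qed.

Lemma amulNr a b : amul a (- b) = - amul a b.
Proof.
rewrite -sub0r (linear_funB _ _ (amul_linearr a)) (linear_fun0 (amul_linearr a)).
exact: sub0r.
Qed.

Lemma astarD a b : astar (a + b) = astar a + astar b.
Proof. by have := astar_semilinear 1 a b; rewrite conjC1 !scale1r. Qed.

Lemma astar0 : astar 0 = 0 :> A.
Proof. by apply: (addrI (astar 0)); rewrite -astarD !addr0. Qed.

Lemma astarN a : astar (- a) = - astar a.
Proof. by apply/eqP; rewrite -addr_eq0 -astarD addNr astar0. Qed.

Lemma astarZ (k : R[i]) a : astar (k *: a) = k^* *: astar a.
Proof. by have := astar_semilinear k a 0; rewrite astar0 !addr0. Qed.

Lemma norm_astar a : `|astar a| = `|a|.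
Proof.
suff le1 b : `|b| <= `|astar b|.
  by apply/eqP; rewrite eq_le le1 andbT -{2}[a]astarK le1.
have [->|b0] := eqVneq b 0; first by rewrite normr0.
rewrite -(@ler_pM2r _ `|b|) ?normr_gt0// -expr2 -astar_norm.
exact: amul_norm.
Qed.

(* [b = 1 - sqrt (1 - c)] in the unitization of [A], as the fixed point of
   [b |-> (c + b^2) / 2] on the ball of radius [`|c|]. *)
Lemma cstar_sqrt c : astar c = c -> `|c| < 1 ->
  exists2 b, astar b = b & b + b - amul b b = c.
Proof.
move=> cs c1; set r := `|c|.
have r0 : 0 <= r by exact: normr_ge0.
pose F b := 2^-1 *: (c + amul b b).
have half_norm x : `|2^-1 *: x : A| = 2^-1 * `|x|.
  by rewrite normrZ ger0_norm// invr_ge0.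
(* [F] contracts with constant [r < 1], by [x^2 - y^2 = x (x - y) + (x - y) y], which holds without
   commutativity. *)
have Flip x y : `|x| <= r -> `|y| <= r -> `|F x - F y| <= r * `|x - y|.
  move=> xr yr; rewrite /F -scalerBr half_norm opprD addrACA subrr add0r.
  rewrite -[leRHS](mulKf (_ : 2 != 0)) ?pnatr_eq0//.
  rewrite ler_wpM2l ?invr_ge0//.
  have -> : amul x x - amul y y = amul x (x - y) + amul (x - y) y.
    by rewrite amulDr amulNr amulDl amulNl addrA subrK.
  rewrite (le_trans (ler_normD _ _))// mulr_natl mulr2n lerD//.
    by rewrite (le_trans (amul_norm _ _))// ler_wpM2r.
  by rewrite (le_trans (amul_norm _ _))// mulrC ler_wpM2r.
have Fr x : `|x| <= r -> `|F x| <= r.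
  move=> xr; rewrite /F half_norm -[leRHS](mulKf (_ : 2 != 0)) ?pnatr_eq0//.
  rewrite ler_wpM2l ?invr_ge0// (le_trans (ler_normD _ _))// mulr_natl mulr2n lerD//.
  rewrite (le_trans (amul_norm _ _))// -[leRHS]mul1r ler_pM//.
  by rewrite (le_trans xr)// ltW.
pose u n := iter n F 0.
have ur n : `|u n| <= r by elim: n => [|n IH]; [rewrite normr0 | exact: Fr].
have us n : astar (u n) = u n.
  elim: n => [|n IH]; first exact: astar0.
  by rewrite /u /= -/(u n) /F astarZ astarD astarM IH cs fmorphV/= conjC_nat.
have udist n k : `|u (n + k)%N - u n| <= r ^+ n * r.
  elim: n => [|n IH]; first by rewrite subr0 expr0 mul1r.
  by rewrite addSn /u /= -/(u _) -/(u n) (le_trans (Flip _ _ _ _))// exprS -mulrA ler_wpM2l.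
have rn (e : R[i]) : 0 < e -> exists N : nat, r ^+ N < e.
  have rr : (complex.Re r)%:C = r by rewrite RRe_real// normr_real.
  move=> e0; have er : e \is Num.real by rewrite gtr0_real.
  rewrite -(RRe_real er) in e0 *; rewrite ltcR in e0.
  have r1 : `|complex.Re r| < 1.
    by rewrite ger0_norm -?ltcR -?lecR rr.
  have /cvgrPdist_lt/(_ _ e0)[N _ /(_ N (leqnn N))] := cvg_expr r1.
  rewrite sub0r normrN => h; exists N; rewrite -rr -rmorphXn ltcR.
  by rewrite (le_lt_trans _ h)// ler_norm.
have [b hb] : exists l, forall e, 0 < e ->
    exists N, forall n, (N <= n)%N -> `|l - u n| < e.
  apply: cauchy_seq_cvg => e e0.
  have [N hN] := rn _ (divr_gt0 e0 (ltr0Sn _ 1)).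
  have near n : (N <= n)%N -> `|u n - u N| < e / 2.
    move=> Nn; rewrite -(subnKC Nn) (le_lt_trans (udist _ _))// (le_lt_trans _ hN)//.
    by rewrite ler_piMr ?exprn_ge0// ltW.
  exists N => n m Nn Nm; rewrite -(subrK (u N) (u n)) -addrA (splitr e).
  by rewrite (le_lt_trans (ler_normD _ _))// ltrD ?near// distrC near.
have br : `|b| <= r.
  apply/ler_addgt0Pl => e /hb[N /(_ N (leqnn N)) h].
  by rewrite -(subrK (u N) b) (le_trans (ler_normD _ _))// lerD// ltW.
have bF : F b = b.
  apply/eqP; rewrite -subr_eq0 -normr_le0; apply/ler_addgt0Pl => e e0; rewrite addr0.
  have [N hN] := hb _ (divr_gt0 e0 (ltr0Sn _ 1)).
  have -> : F b - b = (F b - F (u N)) + (u N.+1 - b) by rewrite addrA subrK.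
  rewrite (le_trans (ler_normD _ _))// (splitr e) lerD//.
    rewrite (le_trans (Flip _ _ _ _))// (le_trans _ (ltW (hN N (leqnn N))))//.
    by rewrite ler_piMl// ltW.
  by rewrite distrC ltW// hN.
exists b.
  apply/eqP; rewrite -subr_eq0 -normr_le0; apply/ler_addgt0Pl => e e0; rewrite addr0.
  have [N /(_ N (leqnn N)) hN] := hb _ (divr_gt0 e0 (ltr0Sn _ 1)).
  have -> : astar b - b = astar (b - u N) + (u N - b).
    by rewrite astarD astarN us addrA subrK.
  rewrite (le_trans (ler_normD _ _))// norm_astar [`|u N - b|]distrC (splitr e).
  by rewrite lerD// ltW.
have : 2 *: F b = b + b by rewrite bF scaler_nat mulr2n.
rewrite /F scalerA mulfV ?pnatr_eq0// scale1r => <-.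
by rewrite addrK.
Qed.

(* [N] stands for the value at the unit: the hypothesis says that [phi]
   extends to a positive functional on the unitization of [A]. *)
Lemma positive_functional_bound (phi : A -> R[i]^o) (N : R[i]) c :
    linear phi ->
    (forall b, 0 <= N + phi b + phi (astar b) + phi (amul (astar b) b)) ->
    astar c = c ->
  phi c <= `|c| * N.
Proof.
move=> phil phi_pos cs.
have N0 : 0 <= N.
  have := phi_pos 0.
  by rewrite astar0 (linear_fun0 (amul_linearr 0)) (linear_fun0 phil) !addr0.
(* With [a = 2 b - b^2] one has [1 - a = (1 - b)^2] in the unitization, so [phi_pos] at [- b] reads
   [0 <= N - phi a]. *)
have bound a : astar a = a -> `|a| < 1 -> phi a <= N.
  move=> as_ /(cstar_sqrt as_)[b bs <-]; rewrite -subr_ge0.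
  have := phi_pos (- b); rewrite astarN bs amulNl amulNr opprK.
  rewrite -sub0r !(linear_funB _ _ phil) (linear_funD _ _ phil) (linear_fun0 phil).
  by congr (0 <= _); rewrite sub0r opprB opprD; ring.
apply/ler_addgt0Pl => e e0.
(* Strictly above the norm of [c], so that [c / k] has norm below [1], while [k * N] exceeds the
   required bound by at most [e]. *)
pose k := `|c| + e / (N + 1).
have N1 : 0 < N + 1 by rewrite ltr_wpDl.
have k0 : 0 < k by rewrite ltr_wpDl// divr_gt0.
have : phi (k^-1 *: c) <= N.
  apply: bound; first by rewrite astarZ cs geC0_conj// invr_ge0 ltW.
  rewrite normrZ ger0_norm ?invr_ge0 1?ltW// mulrC ltr_pdivrMr// mul1r.
  by rewrite ltrDl divr_gt0.
rewrite (linear_funZ _ _ phil) /GRing.scale/= mulrC ler_pdivrMr// => /le_trans; apply.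
rewrite mulrC /k mulrDl addrC lerD2r mulrAC ler_pdivrMr//.
by rewrite ler_pM2l// lerDl.
Qed.

End CStar.

(** * Extension of bounded maps and closed subspaces *)

Section Extension.
Variables (R : realType) (V W : completeNormedModType R[i]) (I : Type).
Variables (e : I -> V) (f : I -> W).

(** The list is a formal combination, which can be evaluated on [e] and on [f] before any map
    between them is known. *)
Definition lin_comb (U : lmodType R[i]) (u : I -> U) (s : seq (R[i] * I)) : U :=
  \sum_(p <- s) p.1 *: u p.2.

Lemma lin_comb_cat (U : lmodType R[i]) (u : I -> U) c s s' :
  lin_comb u ([seq (c * p.1, p.2) | p <- s] ++ s') =
  c *: lin_comb u s + lin_comb u s'.
Proof.
rewrite /lin_comb big_cat big_map scaler_sumr; congr (_ + _).
by apply: eq_bigr => p _; rewrite scalerA.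
Qed.

Lemma lin_span_comb (U : normedModType R[i]) (u : I -> U) v :
  lin_span (range u) v -> exists s, v = lin_comb u s.
Proof.
elim=> [|c _ {}v [i _ <-] _ [s ->]]; first by exists [::]; rewrite /lin_comb big_nil.
by exists ((c, i) :: s); rewrite /lin_comb big_cons.
Qed.

(** The closure of the pairs of values of formal combinations; it is the graph of the extension. *)
Let approx v w := forall eps : R[i], 0 < eps ->
  exists s, `|v - lin_comb e s| < eps /\ `|w - lin_comb f s| < eps.

(** The bound also holds for formal combinations of value zero, so [e i |-> f i] is well defined on
    the span. Completeness of [W] makes the graph [approx] total, and the bound makes it
    single-valued. *)
Lemma bounded_linear_extension (M : R[i]) : 0 <= M ->
    closed_span (range e) = setT ->
    (forall s, `|lin_comb f s| <= M * `|lin_comb e s|) ->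
  exists F : V -> W, [/\ linear F, forall v, `|F v| <= M * `|v|
    & forall i, F (e i) = f i].
Proof.
move=> M0 eT fe.
(* A difference of two combinations is again one, by concatenating lists. *)
have fe2 s s' : `|lin_comb f s - lin_comb f s'| <= M * `|lin_comb e s - lin_comb e s'|.
  have /= := fe ([seq (-1 * p.1, p.2) | p <- s'] ++ s).
  by rewrite !lin_comb_cat !scaleN1r ![- _ + _]addrC.
have approx_ex v : exists w, approx v w.
  have /choice [u hu] : forall n : nat, exists s, `|v - lin_comb e s| < n.+1%:R^-1.
    move=> n; have : closed_span (range e) v by rewrite eT.
    move=> /closed_spanP/(_ n.+1%:R^-1)[|w /lin_span_comb[s ->] vs].
      by rewrite invr_gt0 ltr0Sn.
    by exists s.
  have small (eps : R[i]) : 0 < eps -> exists N, forall n, (N <= n)%N ->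
      `|v - lin_comb e (u n)| < eps.
    move=> /small_invS[N hN]; exists N => n Nn.
    apply: (lt_trans (hu n)); apply: le_lt_trans hN.
    by rewrite lef_pV2 ?posrE ?ltr0Sn// ler_nat.
  have M1 : 0 < M + 1 by rewrite ltr_wpDl.
  have [w hw] : exists w, forall eps, 0 < eps -> exists N, forall n, (N <= n)%N ->
      `|w - lin_comb f (u n)| < eps.
    apply: cauchy_seq_cvg => eps eps0.
    have d0 : 0 < eps / (M + 1) / 2 by rewrite !divr_gt0.
    have [N hN] := small _ d0; exists N => n m Nn Nm.
    rewrite (le_lt_trans (fe2 _ _))//.
    apply: (@le_lt_trans _ _ ((M + 1) * `|lin_comb e (u n) - lin_comb e (u m)|)).
      by rewrite ler_wpM2r// lerDl.
    rewrite mulrC -ltr_pdivlMr// -(subrK v (lin_comb e (u n))) -addrA.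
    rewrite (le_lt_trans (ler_normD _ _))// [ltRHS]splitr.
    by rewrite ltrD ?hN// distrC hN.
  exists w => eps eps0.
  have [N hN] := small _ eps0; have [N' hN'] := hw _ eps0.
  by exists (u (maxn N N')); rewrite hN ?hN' ?leq_maxl ?leq_maxr.
have approx_lin c v w v' w' :
    approx v w -> approx v' w' -> approx (c *: v + v') (c *: w + w').
  move=> vw vw' eps eps0.
  have e20 : 0 < eps / 2 by rewrite divr_gt0.
  have c0 : 0 < `|c| + 1 by rewrite ltr_wpDl.
  have [s [vs ws]] := vw _ (divr_gt0 e20 c0).
  have [s' [vs' ws']] := vw' _ e20.
  have aux (U : normedModType R[i]) (x x' y y' : U) :
      `|x - y| < eps / 2 / (`|c| + 1) -> `|x' - y'| < eps / 2 ->
      `|c *: x + x' - (c *: y + y')| < eps.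
    move=> xy xy'; rewrite opprD addrACA -scalerBr (splitr eps).
    rewrite (le_lt_trans (ler_normD _ _))// ler_ltD// normrZ.
    apply: (@le_trans _ _ ((`|c| + 1) * `|x - y|)).
      by rewrite ler_wpM2r// lerDl.
    by rewrite mulrC -ler_pdivlMr// ltW.
  exists ([seq (c * p.1, p.2) | p <- s] ++ s').
  by rewrite !lin_comb_cat !aux.
have approx_bound v w : approx v w -> `|w| <= M * `|v|.
  move=> vw; apply/ler_addgt0Pl => eps eps0.
  have M1 : 0 < M + 1 by rewrite ltr_wpDl.
  have [s [vs ws]] := vw _ (divr_gt0 eps0 M1).
  rewrite -(subrK (lin_comb f s) w) (le_trans (ler_normD _ _))//.
  rewrite (le_trans (lerD (ltW ws) (fe s)))//.
  have : `|lin_comb e s| <= eps / (M + 1) + `|v|.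
    rewrite -[lin_comb e s](subrK v) (le_trans (ler_normD _ _))// lerD2r distrC.
    exact: ltW.
  move=> /(ler_wpM2l M0) /(lerD (lexx (eps / (M + 1)))) /le_trans; apply.
  rewrite mulrDr addrA lerD2r -[X in X + _]mul1r -mulrDl addrC mulrC divfK//.
  by rewrite gt_eqF.
have [F hF] := choice approx_ex.
have F_uniq v w : approx v w -> F v = w.
  move=> vw; apply/eqP; rewrite -subr_eq0 -normr_le0.
  have := approx_bound _ _ (approx_lin (-1) _ _ _ _ vw (hF v)).
  by rewrite !scaleN1r addNr normr0 mulr0 addrC.
exists F; split=> [c x y|v|i]; [exact/F_uniq/approx_lin | exact: approx_bound|].
apply: F_uniq => eps eps0; exists [:: (1, i)].
by rewrite /lin_comb !big_seq1 !scale1r !subrr !normr0.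
Qed.

End Extension.

(** Families with the same Gram matrix give every formal combination the same norm. *)
Lemma isometry_extension (R : realType) (V W : hilbertType R) (I : Type)
    (e : I -> V) (f : I -> W) :
    closed_span (range e) = setT ->
    (forall i k, hip (f i) (f k) = hip (e i) (e k)) ->
  exists F : V -> W, lin_isometry F /\ forall i, F (e i) = f i.
Proof.
move=> eT fe.
have nfe s : `|lin_comb f s| = `|lin_comb e s|.
  apply/eqP; rewrite -(@eqrXn2 _ 2)// -!hip_norm !hip_suml; apply/eqP.
  apply: eq_bigr => p _; rewrite !hip_sumr; apply: eq_bigr => q _.
  by rewrite !hipZl !hipZr fe.
have [|F [Fl Fb Fe]] := @bounded_linear_extension _ _ _ _ e f 1 ler01 eT.
  by move=> s; rewrite nfe mul1r.
exists F; split=> //; apply: hip_lin_isometry => // x.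
have bF : bounded_linear F by split=> //; exists 1.
have bI := bounded_linear_id V.
have hFe i : forall y, hip (F (e i)) (F y) = hip (e i) y.
  by apply: (hip_eq_total_r eT) => // _ [k _ <-]; rewrite !Fe fe.
move=> y; move: x; apply: (hip_eq_total_l eT) => // _ [i _ <-]; exact: hFe.
Qed.

(** * Closed spans as Hilbert spaces *)

Section ClosedSubspace.
Variables (R : realType) (L : hilbertType R) (B : set L).

Record closed_subspace := ClosedSubspace {
  csub_val : L;
  csub_in : csub_val \in closed_span B }.

HB.instance Definition _ := [isSub for csub_val].
HB.instance Definition _ := [Choice of closed_subspace by <:].

Lemma closed_span_submod_closed : subsemimod_closed (mem (closed_span B)).
Proof.
split; first split; first by rewrite inE; exact: closed_span0.
  by move=> u v; rewrite !inE => Bu Bv; rewrite -[u]scale1r; exact: closed_span_lin.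
move=> c v; rewrite !inE -[c *: v]addr0 => Bv; apply: closed_span_lin => //.
exact: closed_span0.
Qed.

HB.instance Definition _ := GRing.SubChoice_isSubLmodule.Build R[i] L
  (mem (closed_span B)) closed_subspace closed_span_submod_closed.

Let nrm (x : closed_subspace) : R[i] := `|val x|.

Let nrmD x y : nrm (x + y) <= nrm x + nrm y.
Proof. by rewrite /nrm raddfD ler_normD. Qed.

Let nrmZ (c : R[i]) x : nrm (c *: x) = `|c| * nrm x.
Proof. by rewrite /nrm linearZ normrZ. Qed.

Let nrm_eq0 x : nrm x = 0 -> x = 0.
Proof. by move=> /normr0_eq0 x0; apply: val_inj; rewrite x0 raddf0. Qed.

HB.instance Definition _ :=
  Lmodule_isNormed.Build R[i] closed_subspace nrmD nrmZ nrm_eq0.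

Let csub_complete (F : set_system closed_subspace) :
  ProperFilter F -> cauchy F -> cvg F.
Proof.
move=> FF Fc; have /cauchy_cvgP/cvg_ex[l /cvgrPdist_lt Fl] : cauchy (val @ F : set_system L).
  apply/cauchy_ballP => e e0.
  move/cauchy_ballP: Fc => /(_ e e0); rewrite /= !near_map2.
  apply: filterS => -[x y] /=.
  by rewrite -!ball_normE /ball_/=.
have lB : l \in closed_span B.
  rewrite inE; apply: closed_span_approx => e e0.
  have /filter_ex[x lx] := Fl e e0.
  by exists (val x) => //; have := valP x; rewrite inE.
apply/cvg_ex; exists (ClosedSubspace lB); apply/cvgrPdist_lt => e e0.
exact: Fl e e0.
Qed.

HB.instance Definition _ := Uniform_isComplete.Build closed_subspace csub_complete.

Let csub_hip (x y : closed_subspace) : R[i] := hip (val x) (val y).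

Let csub_hip_lin x (c : R[i]) y z :
  csub_hip x (c *: y + z) = c * csub_hip x y + csub_hip x z.
Proof. by rewrite /csub_hip linearP hip_linear. Qed.

Let csub_hip_conj x y : csub_hip y x = (csub_hip x y)^*%C.
Proof. exact: hip_conj. Qed.

Let csub_hip_norm x : csub_hip x x = `|x| ^+ 2.
Proof. exact: hip_norm. Qed.

HB.instance Definition _ := CompleteNormedModule_isHilbert.Build R closed_subspace
  csub_hip_lin csub_hip_conj csub_hip_norm.

(** The subtype is hidden behind an isometry [j]. The last clause transfers totality: [B] spans
    densely inside [K], not only inside its image in [L]. *)
Lemma closed_subspace_ex : exists (K : hilbertType R) (j : K -> L),
  [/\ lin_isometry j, forall b, B b -> exists k, j k = b
    & closed_span [set k | B (j k)] = setT].
Proof.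
exists closed_subspace, csub_val.
have jl : linear (val : closed_subspace -> L) by move=> c x y; rewrite linearP.
split; first by split.
  move=> b Bb; have bB : b \in closed_span B by rewrite inE; exact: closed_span_mem.
  by exists (ClosedSubspace bB).
apply/seteqP; split=> // x _; apply/closed_spanP => e e0.
have := valP x; rewrite inE => /closed_spanP/(_ e e0)[w Bw xw].
suff [y By yw] : exists2 y : closed_subspace,
    lin_span [set k | B (csub_val k)] y & val y = w.
  by exists y => //; rewrite -yw in xw.
elim: Bw => [|c b v Bb _ [y By <-]]; first by exists 0; [left|exact: raddf0].
have bB : b \in closed_span B by rewrite inE; exact: closed_span_mem.
exists (c *: ClosedSubspace bB + y); first by right.
by rewrite linearP.
Qed.

End ClosedSubspace.

(** * Correspondences and product systems *)

Section CorrTheory.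
Variables (R : realType) (A : cstarAlgType R).
Implicit Types E F : corrType A.

Lemma ipBr E (x y z : E) : ip x (y - z) = ip x y - ip x z.
Proof. exact: linear_funB (ip_linear x). Qed.

Lemma ip_eq0 E (x : E) : ip x x = 0 -> x = 0.
Proof.
move=> h; have := ip_norm x; rewrite h normr0 => /esym/eqP.
by rewrite sqrf_eq0 normr_eq0 => /eqP.
Qed.

Lemma ip_ractl E (x y : E) a : ip (cract x a) y = amul (astar a) (ip x y).
Proof. by rewrite -ip_star ip_ract astarM ip_star. Qed.

Lemma corr_iso_norm E F (U : E -> F) x : corr_iso U -> `|U x| = `|x|.
Proof.
by case=> _ _ Ui _ _; apply/eqP; rewrite -(@eqrXn2 _ 2)// -!ip_norm Ui.
Qed.

End CorrTheory.

(** * Multiplication in a product system *)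

Section ProductSystemTheory.
Variables (R : realType) (Omega : Type) (Sg : Omega -> commSubsemigroup R).
Variables (A : cstarAlgType R) (X : productSystem Sg A).
Local Notation S := (fsupp Sg).
Implicit Types s t u m n : S.

Lemma fsupp_addE s t j : (s + t) j = s j + t j.
Proof. by []. Qed.

Lemma fsupp_add_neq0 s t : s != 0 -> s + t != 0.
Proof.
apply: contra_neq => st0; apply: fsupp_ext => j; apply/eqP.
have s0 := cs_ge0 (fs_in s j); have t0 := cs_ge0 (fs_in t j).
have : (s + t) j == 0 by rewrite st0.
by rewrite fsupp_addE paddr_eq0// => /andP[].
Qed.

(** An element of the disjoint union. Associativity and the unit laws compare fibres whose indices
    are only provably equal, so they are stated through [elt] and carried to other quantities by
    [elt_fun]. *)
Definition elt s (x : X s) : {s : S & (X s : Type)} := existT _ s x.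

Lemma elt_inj s : injective (@elt s).
Proof.
move=> x y e; have := projT2_eq e.
by rewrite (Prop_irrelevance (projT1_eq e) erefl).
Qed.

Lemma elt_fun (Z : Type) (F : forall s, X s -> Z) s t (x : X s) (y : X t) :
  elt x = elt y -> F s x = F t y.
Proof. exact: (f_equal (fun p => F (projT1 p) (projT2 p))). Qed.

Lemma elt_fun2 (Z : Type) (F : forall s, X s -> X s -> Z) s t (x x' : X s)
    (y y' : X t) :
  elt x = elt y -> elt x' = elt y' -> F s x x' = F t y y'.
Proof.
move=> /[dup] /(f_equal (@projT1 _ _)) /= e; subst t.
by move=> /elt_inj -> /elt_inj ->.
Qed.

Lemma elt_mulA s t u (x : X s) (y : X t) (z : X u) :
  elt (ps_mul (ps_mul x y) z) = elt (ps_mul x (ps_mul y z)).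
Proof. exact: ps_mulA. Qed.

Lemma elt_unit_mul s a (x : X s) :
  elt (ps_mul (ps_unit X a) x) = elt (clact a x).
Proof. exact: ps_mul0l. Qed.

Lemma elt_mul_unit s (x : X s) a :
  elt (ps_mul x (ps_unit X a)) = elt (cract x a).
Proof. exact: ps_mul0r. Qed.

Lemma ps_unit_surj (x : X 0) : exists a, x = ps_unit X a.
Proof. by have [g _ gK] := ps_unit_bij X; exists (g x). Qed.

(** For nonzero indices this is the inner product of the balanced tensor product, carried over by
    the isomorphism; at index [0] it follows from the identification of [X 0] with [A]. *)
Lemma ip_mul s t (x x' : X s) (y y' : X t) :
  ip (ps_mul x y) (ps_mul x' y') = ip y (clact (ip x x') y').
Proof.
case: (eqVneq s 0) x x' => [->|s0] x x'.
  have [a ->] := ps_unit_surj x; have [b ->] := ps_unit_surj x'.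
  have := @elt_fun2 _ (fun s => @ip _ _ (X s)) _ _ _ _ _ _
    (elt_unit_mul a y) (elt_unit_mul b y').
  by move=> ->; rewrite ps_unit_ip clact_adj clactA.
case: (eqVneq t 0) y y' => [->|t0] y y'.
  have [a ->] := ps_unit_surj y; have [b ->] := ps_unit_surj y'.
  have := @elt_fun2 _ (fun s => @ip _ _ (X s)) _ _ _ _ _ _
    (elt_mul_unit x a) (elt_mul_unit x' b).
  by move=> ->; rewrite ip_ract ip_ractl ps_unit_lact ps_unit_ip amulA.
have [Z [ten [U [[_ tenip _ _ _] [_ _ Uip _ _] Uten]]]] := @ps_iso _ _ _ _ X _ _ s0 t0.
by rewrite -!Uten Uip tenip.
Qed.

(** The defect of linearity is a combination of products and, by [ip_mul], orthogonal to all of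
    them, hence to itself. *)
Lemma ps_mul_linearl s t (y : X t) : linear (fun x : X s => ps_mul x y).
Proof.
move=> c x x'; apply/eqP; rewrite -subr_eq0; apply/eqP/ip_eq0.
set d := (X in ip X X).
have d0 w : ip (ps_mul w y) d = 0.
  rewrite /d ipBr ip_linear !ip_mul !ip_linear clact_linearl.
  by rewrite ip_linear subrr.
have d0' w : ip d (ps_mul w y) = 0 by rewrite -ip_star d0 astar0.
by rewrite {2}/d ipBr ip_linear !d0' scaler0 addr0 subr0.
Qed.

Lemma ps_mul_linearr s t (x : X s) : linear (fun y : X t => ps_mul x y).
Proof.
move=> c y y'; apply/eqP; rewrite -subr_eq0; apply/eqP/ip_eq0.
set d := (X in ip X X).
have d0 w : ip (ps_mul x w) d = 0.
  by rewrite /d ipBr ip_linear !ip_mul clact_linearr ip_linear subrr.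
have d0' w : ip d (ps_mul x w) = 0 by rewrite -ip_star d0 astar0.
by rewrite {2}/d ipBr ip_linear !d0' scaler0 addr0 subr0.
Qed.

Lemma ps_mul_total s t : s != 0 -> t != 0 ->
  closed_span [set z : X (s + t) | exists x y, z = ps_mul x y] = setT.
Proof.
move=> s0 t0.
have [Z [ten [U [[_ _ _ _ tenT] Uiso Uten]]]] := @ps_iso _ _ _ _ X _ _ s0 t0.
have [Ul [g _ gK] _ _ _] := Uiso; have nU := corr_iso_norm _ Uiso.
apply/seteqP; split=> // z _; rewrite -(gK z); move: (g z) => {}z.
have : closed_span [set v | exists x y, v = ten x y] z by rewrite tenT.
move: z; apply: closed_span_ind.
- by rewrite (linear_fun0 Ul); exact: closed_span0.
- by move=> _ [x [y ->]]; rewrite Uten; apply: closed_span_mem; exists x, y.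
- by move=> c v w hv hw; rewrite Ul; exact: closed_span_lin.
move=> v hv; apply: closed_span_approx => e /hv[w Bw vw].
by exists (U w) => //; rewrite -(linear_funB _ _ Ul) nU.
Qed.

End ProductSystemTheory.

(** * The Fock space of a representation *)

Section InteriorTensorTheory.
Variables (R : realType) (A : cstarAlgType R).

(* [v] is a cyclic vector of a *-representation of [A] on the span of the
   vectors [w a = a v]. *)
Lemma cyclic_vector_bound (L : hilbertType R) (v : L) (w : A -> L) c :
    linear w ->
    (forall a b, hip (w a) (w b) = hip v (w (amul (astar a) b))) ->
    (forall a, hip (w a) v = hip v (w (astar a))) ->
    astar c = c ->
  hip v (w c) <= `|c| * `|v| ^+ 2.
Proof.
move=> wl ww wv; apply: (@positive_functional_bound _ _ (fun a => hip v (w a))).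
  by move=> k a b; rewrite wl hip_linear.
move=> b; rewrite -ww -wv -hip_norm.
have := hip_ge0 (v + w b); rewrite hipDl !hipDr.
by congr (0 <= _); ring.
Qed.

Variables (E : corrType A) (H : hilbertType R) (sigma : A -> H -> H).
Hypothesis sigma_hom : star_hom sigma.
Variable Y : interiorTensor E sigma.

Lemma star_hom_linear h : linear (sigma^~ h).
Proof. by case: sigma_hom => _ + _ _ => sl c a b; exact: sl. Qed.

Lemma star_homM a b h : sigma (amul a b) h = sigma a (sigma b h).
Proof. by case: sigma_hom. Qed.

Lemma star_hom_adj a h g : hip (sigma a h) g = hip h (sigma (astar a) g).
Proof. by case: sigma_hom => _ _ _; exact. Qed.

(** The left side squared is [<h, sigma(<x,x>) h>], and [h] is a cyclic vector for
    [a |-> sigma a h]. *)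
Lemma ten_norm x h : `|ten Y x h| <= `|x| * `|h|.
Proof.
rewrite -(@ler_pXn2r _ 2) ?nnegrE ?mulr_ge0// exprMn -hip_norm ten_ip -ip_norm.
apply: (cyclic_vector_bound (w := sigma^~ h)); last exact: ip_star.
- exact: star_hom_linear.
- by move=> a b; rewrite star_hom_adj star_homM.
- by move=> a; rewrite star_hom_adj.
Qed.

Lemma ten_lact_bound x h c : astar c = c ->
  hip (ten Y x h) (ten Y (clact c x) h) <= `|c| * `|ten Y x h| ^+ 2.
Proof.
apply: (cyclic_vector_bound (w := fun a => ten Y (clact a x) h)).
- by move=> k a b; rewrite clact_linearl ten_linearl.
- by move=> a b; rewrite !ten_ip clact_adj clactA.
- by move=> a; rewrite !ten_ip clact_adj.
Qed.

Lemma ten_cract x a h : ten Y (cract x a) h = ten Y x (sigma a h).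
Proof.
apply/eqP; rewrite -subr_eq0; apply/eqP/hip_eq0; set d := (X in hip X X).
have d0 y g : hip (ten Y y g) d = 0.
  by rewrite /d hipBr !ten_ip ip_ract star_homM subrr.
by rewrite {1}/d hipBl !d0 subrr.
Qed.

End InteriorTensorTheory.

(** * Elementary vectors of the Fock space and the action of [That] *)

Section Fock.
Variables (R : realType) (Omega : Type) (Sg : Omega -> commSubsemigroup R).
Variables (A : cstarAlgType R) (X : productSystem Sg A).
Local Notation S := (fsupp Sg).
Variables (H : hilbertType R) (T : forall s : S, X s -> H -> H).
Arguments T : clear implicits.
Hypothesis T_rep : is_representation T.
Variable Y : forall s : S, interiorTensor (X s) (rep0 T).
Variable Tt : forall s : S, Y s -> H.
Arguments Tt : clear implicits.
Hypothesis Tt_tilde : forall s : S, is_tilde (T s) (Tt s).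
Variable Hh : hilbertSum (hat_component Y).
Variable That : S -> Hh -> Hh.
Hypothesis That_hat : is_hat_semigroup Tt That.
Implicit Types s t u m n : S.
Local Notation sigma := (rep0 T).

Lemma rep0_star_hom : star_hom sigma.
Proof. by have [/(_ 0)[]] := T_rep. Qed.

Lemma rep_mul s t (x : X s) (y : X t) h : T _ (ps_mul x y) h = T s x (T t y h).
Proof. exact: T_rep.2. Qed.

Lemma rep_linear s h : linear (fun x : X s => T s x h : H).
Proof. by have [/(_ s)[_ [_ Tl] _ _ _] _] := T_rep; move=> c x y; exact: Tl. Qed.

Lemma tilde_ten s (x : X s) h : Tt s (ten (Y s) x h) = T s x h.
Proof. exact: (Tt_tilde s).2. Qed.

Lemma rep_norm s (x : X s) h : `|T s x h| <= `|x| * `|h|.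
Proof.
rewrite -tilde_ten (le_trans ((Tt_tilde s).1.2 _))// ten_norm//.
exact: rep0_star_hom.
Qed.

Lemma rep_bounded s (x : X s) : bounded_linear (T s x).
Proof.
split; first by have [/(_ s)[_ [/(_ x)[]]]] := T_rep.
by exists `|x| => // h; exact: rep_norm.
Qed.

Lemma ten_mul_norm s t (x : X s) (y : X t) h :
  `|ten (Y (s + t)) (ps_mul x y) h| <= `|x| * `|ten (Y t) y h|.
Proof.
rewrite -(@ler_pXn2r _ 2) ?nnegrE ?mulr_ge0// exprMn -hip_norm ten_ip ip_mul -(ten_ip (Y t)).
by rewrite -ip_norm ten_lact_bound ?ip_star//; exact: rep0_star_hom.
Qed.

(* The index [s = 0] is not one of the direct sum: there [a (x) h] is sent to
   [sigma a h] in the summand [H]. *)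
Definition fock_ten s (x : X s) (h : H) : Hh :=
  if pselect (s != 0) is left hs then delta Hh hs (ten (Y s) x h)
  else delta0 Hh (T s x h).

Lemma delta0_isom : lin_isometry (delta0 Hh).
Proof. exact: (@hs_isom _ _ _ Hh None). Qed.

Lemma delta_isom s (hs : s != 0) : lin_isometry (delta Hh hs).
Proof. exact: (@hs_isom _ _ _ Hh (Some (exist _ s hs))). Qed.

Lemma fock_ten0 (x : X 0) h : fock_ten x h = delta0 Hh (T 0 x h).
Proof. by rewrite /fock_ten; case: pselect => // h0; case/eqP: (h0). Qed.

Lemma fock_ten_neq0 s (hs : s != 0) (x : X s) h :
  fock_ten x h = delta Hh hs (ten (Y s) x h).
Proof.
by rewrite /fock_ten; case: pselect => // hs'; rewrite (Prop_irrelevance hs' hs).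
Qed.

(** The convention at index [0] pays off here: one formula serves all indices. *)
Lemma fock_ten_hip s (x y : X s) h g :
  hip (fock_ten x h) (fock_ten y g) = hip h (sigma (ip x y) g).
Proof.
have [s0|s0] := eqVneq s 0; last first.
  by rewrite !(fock_ten_neq0 s0) (lin_isometry_hip (delta_isom s0)) ten_ip.
subst s; rewrite !fock_ten0 (lin_isometry_hip delta0_isom).
have [a ->] := ps_unit_surj x; have [b ->] := ps_unit_surj y.
rewrite ps_unit_ip (star_homM rep0_star_hom) -[T 0 _ h]/(sigma a h).
by rewrite (star_hom_adj rep0_star_hom).
Qed.

Lemma fock_ten_norm s (x : X s) h : `|fock_ten x h| = `|ten (Y s) x h|.
Proof. by apply/eqP; rewrite -(@eqrXn2 _ 2)// -!hip_norm fock_ten_hip ten_ip. Qed.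

Lemma fock_ten_linear s h : linear (fun x : X s => fock_ten x h).
Proof.
move=> c x y; have [s0|s0] := eqVneq s 0; last first.
  by rewrite !(fock_ten_neq0 s0) ten_linearl (delta_isom s0).1.
by subst s; rewrite !fock_ten0 rep_linear delta0_isom.1.
Qed.

Lemma fock_ten_linearr s (x : X s) : linear (fock_ten x).
Proof.
move=> c h g; have [s0|s0] := eqVneq s 0; last first.
  by rewrite !(fock_ten_neq0 s0) ten_linearr (delta_isom s0).1.
by subst s; rewrite !fock_ten0 (rep_bounded x).1 delta0_isom.1.
Qed.

Lemma fock_ten_bounded s h : bounded_linear (fun x : X s => fock_ten x h).
Proof.
split; first exact: fock_ten_linear.
exists `|h| => // x; rewrite fock_ten_norm mulrC ten_norm//.
exact: rep0_star_hom.
Qed.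

Lemma fock_ten_mul_bounded s (x : X s) t h :
  bounded_linear (fun y : X t => fock_ten (ps_mul x y) h).
Proof.
split; first by move=> c y z; rewrite (ps_mul_linearr x) fock_ten_linear.
exists (`|x| * `|h|) => [|y]; first by rewrite mulr_ge0.
rewrite fock_ten_norm (le_trans (ten_mul_norm _ _ _))// -mulrA ler_wpM2l// mulrC.
by rewrite ten_norm//; exact: rep0_star_hom.
Qed.

Lemma That_bounded s : bounded_linear (That s).
Proof. by apply: contraction_bounded; have [[]] := That_hat. Qed.

Lemma That0 v : That 0 v = v.
Proof. by have [[]] := That_hat. Qed.

Lemma fock_ten_elt s t (x : X s) (y : X t) h :
  elt x = elt y -> fock_ten x h = fock_ten y h.
Proof. exact: (elt_fun (fun s x => @fock_ten s x h)). Qed.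

Lemma That_fock_ten_diag n (y : X n) h : That n (fock_ten y h) = delta0 Hh (T n y h).
Proof.
have [n0|n0] := eqVneq n 0; first by subst n; rewrite That0 fock_ten0.
rewrite (fock_ten_neq0 n0); have [_ /(_ n n0)[_ _ -> _]] := That_hat.
by rewrite tilde_ten.
Qed.

(** For nonzero [m] and [n] this is the defining clause of [That]. For [n = 0] the element [y] is a
    scalar that moves across the tensor sign, and for [m = 0] the value lies in the summand [H]. *)
Lemma That_fock_ten_mul m n (x : X m) (y : X n) h :
  That n (fock_ten (ps_mul x y) h) = fock_ten x (T n y h).
Proof.
have [n0|n0] := eqVneq n 0.
  subst n; have [a ->] := ps_unit_surj y; rewrite That0.
  rewrite (fock_ten_elt _ (elt_mul_unit x a)).
  have [m0|m0] := eqVneq m 0; last first.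
    by rewrite !(fock_ten_neq0 m0) (ten_cract rep0_star_hom).
  subst m; rewrite !fock_ten0; have [/(_ 0)[_ _ _ Tr _] _] := T_rep.
  by rewrite Tr.
have [m0|m0] := eqVneq m 0.
  subst m; have [a ->] := ps_unit_surj x.
  rewrite (fock_ten_elt _ (elt_unit_mul a y)) That_fock_ten_diag fock_ten0.
  by have [/(_ n)[_ _ _ _ Tl] _] := T_rep; rewrite Tl.
rewrite (fock_ten_neq0 (fsupp_add_neq0 n m0)) (fock_ten_neq0 m0) -tilde_ten.
by have [_ /(_ n n0)[_ _ _ ->]] := That_hat.
Qed.

(* With [F u x] and [F' u x] read as [x v] and [x w], this says that
   [<x v, y w> = <v, <x, y> w>] and [<a v, w> = <v, a^* w>]. *)
Definition compatible (G : hilbertType R) (v w : G) (F F' : forall u, X u -> G) :=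
  (forall u (x y : X u), hip (F u x) (F' u y) = hip v (F' 0 (ps_unit X (ip x y)))) /\
  (forall a, hip (F 0 (ps_unit X a)) w = hip v (F' 0 (ps_unit X (astar a)))).

Lemma compatible_sym (G : hilbertType R) (v w : G) F F' :
  compatible v w F F' -> compatible w v F' F.
Proof.
move=> [FF Fw]; split=> [u x y|a].
  by rewrite hipC FF -[RHS]conjCK -[(hip w _)^*]hipC Fw ip_star.
by rewrite hipC [RHS]hipC Fw astarK.
Qed.

Lemma compatible_ext (G : hilbertType R) (v v' w w' : G)
    (F1 F2 F1' F2' : forall u, X u -> G) :
    v = v' -> w = w' -> (forall u x, F1 u x = F2 u x) ->
    (forall u x, F1' u x = F2' u x) ->
  compatible v' w' F2 F2' -> compatible v w F1 F1'.
Proof.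
move=> -> -> F12 F12' [c1 c2]; split=> [u x y|a].
  by rewrite F12 !F12' c1.
by rewrite F12 !F12' c2.
Qed.

Lemma compatible_fock_ten m (p p' : X m) h h' :
  compatible (fock_ten p h) (fock_ten p' h')
    (fun u x => fock_ten (ps_mul x p) h) (fun u x => fock_ten (ps_mul x p') h').
Proof.
split=> [u x y|a]; rewrite !(fock_ten_elt _ (elt_unit_mul _ _)) !fock_ten_hip.
  by rewrite ip_mul.
by rewrite clact_adj.
Qed.

Lemma compatible_delta0 h h' :
  compatible (delta0 Hh h) (delta0 Hh h')
    (fun u x => fock_ten x h) (fun u x => fock_ten x h').
Proof.
split=> [u x y|a]; rewrite !fock_ten0 (lin_isometry_hip delta0_isom) ?fock_ten_hip//.
by rewrite (lin_isometry_hip delta0_isom) (star_hom_adj rep0_star_hom).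
Qed.

(** By density [y] may be taken to be a product [p q], and then [That n] turns the vector into
    [p (x) T(q) h], where the premise applies. *)
Lemma compatible_dense m n v F h (y : X (m + n)) : m != 0 ->
    (forall (p : X m) g, compatible v (fock_ten p g) F
       (fun u x => fock_ten (ps_mul x p) g)) ->
  compatible v (That n (fock_ten y h)) F
    (fun u x => That n (fock_ten (ps_mul x y) h)).
Proof.
(* For [n = 0] the operator is the identity and [y] lies in [X m], so the premise applies to [y]
   itself. *)
move=> m0 hp; have [n0|n0] := eqVneq n 0.
  subst n; move: y; rewrite addr0 => y.
  by apply: compatible_ext (hp y h) => // *; exact: That0.
have PT := ps_mul_total X m0 n0.
have hmul (p : X m) (q : X n) : compatible v (That n (fock_ten (ps_mul p q) h)) F
    (fun u x => That n (fock_ten (ps_mul x (ps_mul p q)) h)).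
  apply: compatible_ext (hp p (T n q h)) => // [|u x].
    exact: That_fock_ten_mul.
  by rewrite -That_fock_ten_mul; congr (That _ _); apply/fock_ten_elt/esym/elt_mulA.
have bT u (x : X u) : bounded_linear
    (fun y : X (m + n) => That n (fock_ten (ps_mul x y) h)).
  exact: bounded_linear_comp (fock_ten_mul_bounded _ _ _) (That_bounded n).
split=> [u x x'|a]; move: y; apply: (hip_eq_total_r PT) => //.
- by move=> _ [p [q ->]]; exact: (hmul p q).1.
- exact: bounded_linear_comp (fock_ten_bounded _ _) (That_bounded n).
- by move=> _ [p [q ->]]; exact: (hmul p q).2.
Qed.

(** Both vectors lie in the component of index [m]. If [m = 0] they lie in [H]; otherwise
    [compatible_dense] reduces each argument in turn, the two being exchanged by
    [compatible_sym]. *)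
Lemma compatible_That m n n' s t (y : X s) (z : X t) h h' :
    s = m + n -> t = m + n' ->
  compatible (That n (fock_ten y h)) (That n' (fock_ten z h'))
    (fun u x => That n (fock_ten (ps_mul x y) h))
    (fun u x => That n' (fock_ten (ps_mul x z) h')).
Proof.
have [->|m0] := eqVneq m 0.
  rewrite !add0r => sn tn'; subst s t.
  apply: compatible_ext (compatible_delta0 (T n y h) (T n' z h')) => [||u x|u x];
    by rewrite ?That_fock_ten_diag ?That_fock_ten_mul.
move=> ss tt; subst s t.
apply: compatible_dense => // p g; apply: compatible_sym.
apply: compatible_dense => // p' g'; exact: compatible_fock_ten.
Qed.

End Fock.

(** * Generators of the dilation space *)

Section IsometricCompletelyContractive.
Variables (R : realType) (A : cstarAlgType R) (E : corrType A).
Variables (H : hilbertType R) (sigma : A -> H -> H) (T : E -> H -> H).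
Hypothesis sigma_hom : star_hom sigma.
Hypothesis T_ip : forall x y h g, hip (T x h) (T y g) = hip h (sigma (ip x y) g).

Let mx_form n (h : 'I_n -> H) (M : 'M[A]_n) : R[i] :=
  \sum_j \sum_k hip (h j) (sigma (M j k) (h k)).

Let sigma_sum n (F : 'I_n -> A) h :
  sigma (\sum_i F i) h = \sum_i sigma (F i) h.
Proof. exact: (linear_fun_sum _ _ (star_hom_linear sigma_hom h)). Qed.

Let astar_sum n (F : 'I_n -> A) : astar (\sum_i F i) = \sum_i astar (F i).
Proof. by apply: (big_morph astar) => [a b|]; [exact: astarD | exact: astar0]. Qed.

(** The left side is the value at [mx_ip x] of the vector functional [mx_form h] on matrices over
    [A], which is positive and has the value [\sum_j |h j|^2] at the unit. *)
Lemma isometric_completely_contractive : completely_contractive T.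
Proof.
move=> n B phi [[psi phiK psiK] phil phiM phis] x h.
have -> : \sum_i `|\sum_j T (x i j) (h j)| ^+ 2 = mx_form h (mx_ip x).
  rewrite /mx_form; under [RHS]eq_bigr => j _.
    under eq_bigr => k _ do rewrite mxE sigma_sum hip_sumr.
    rewrite exchange_big; over.
  rewrite exchange_big /=; apply: eq_bigr => i _.
  rewrite -hip_norm hip_suml; apply: eq_bigr => j _.
  by rewrite hip_sumr; apply: eq_bigr => k _; rewrite T_ip.
have psil (c : R[i]) a b :
    psi (c *: a + b) = map_mx (fun a => c *: a) (psi a) + psi b.
  by apply: (can_inj phiK); rewrite phil !psiK.
have psiM a b : psi (amul a b) = mx_amul (psi a) (psi b).
  by apply: (can_inj phiK); rewrite phiM !psiK.
have psis a : psi (astar a) = mx_astar (psi a).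
  by apply: (can_inj phiK); rewrite phis !psiK.
rewrite -[X in mx_form h X]phiK.
apply: (@positive_functional_bound _ _ (fun b => mx_form h (psi b))); last first.
- rewrite -phis; congr phi; apply/matrixP => j k; rewrite !mxE astar_sum.
  by apply: eq_bigr => i _; rewrite ip_star.
- move=> b; rewrite psiM psis; move: (psi b) => M.
  (* This is [(1 + M) h]; its squared norm is the expression whose positivity is required. *)
  pose k i := h i + \sum_j sigma (M i j) (h j).
  have : 0 <= \sum_i hip (k i) (k i) by apply: sumr_ge0 => i _; exact: hip_ge0.
  congr (0 <= _).
  rewrite /k; under eq_bigr => i _ do rewrite hipDl !hipDr hip_norm.
  rewrite !big_split /= -!addrA; congr (_ + (_ + _)).
    by apply: eq_bigr => i _; rewrite hip_sumr.
  congr (_ + _).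
    rewrite /mx_form exchange_big; apply: eq_bigr => i _.
    rewrite hip_suml; apply: eq_bigr => j _.
    by rewrite mxE (star_hom_adj sigma_hom).
  rewrite /mx_form; under [RHS]eq_bigr => j _.
    under eq_bigr => l _ do rewrite mxE sigma_sum hip_sumr.
    rewrite exchange_big; over.
  rewrite exchange_big /=; apply: eq_bigr => i _.
  rewrite hip_suml; apply: eq_bigr => j _; rewrite hip_sumr; apply: eq_bigr => l _.
  by rewrite mxE (star_homM sigma_hom) (star_hom_adj sigma_hom).
move=> c a b; rewrite psil /mx_form /GRing.scale /= mulr_sumr -big_split.
apply: eq_bigr => j _; rewrite mulr_sumr -big_split; apply: eq_bigr => l _ /=.
by rewrite !mxE (star_hom_linear sigma_hom) hip_linear.
Qed.

End IsometricCompletelyContractive.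

(** * Inner products of the generators *)

Section Dilation.
Variables (R : realType) (Omega : Type) (Sg : Omega -> commSubsemigroup R).
Local Notation S := (fsupp Sg).
Implicit Types s t m n : S.

Lemma min_fin s t : finite_set [set j | Num.min (s j) (t j) != 0].
Proof.
apply: sub_finite_set (fsupp_add_fin s t) => j /=.
apply: contra_neq => st0; have s0 := cs_ge0 (fs_in s j); have t0 := cs_ge0 (fs_in t j).
have /andP[/eqP -> _] : (s j == 0) && (t j == 0) by rewrite -paddr_eq0// st0.
by rewrite min_l.
Qed.

Lemma min_in s t j : Sg j (Num.min (s j) (t j)).
Proof. by rewrite /Num.min; case: ifP => _; exact: fs_in. Qed.

Definition fsupp_min s t : S := FSupp (min_fin s t) (min_in s t).

Lemma sub_in_diff s t : in_diff Sg (fun j => s j - t j).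
Proof. by exists s, t. Qed.

Lemma min_pos_part s t : s = fsupp_min s t + pos_part (sub_in_diff s t).
Proof.
apply: fsupp_ext => j /=; have [ts|st] := leP (t j) (s j).
  by rewrite max_r ?subr_ge0// addrC subrK.
by rewrite max_l ?subr_le0 ?(ltW st)// addr0.
Qed.

Lemma min_neg_part s t : t = fsupp_min s t + neg_part (sub_in_diff s t).
Proof.
apply: fsupp_ext => j /=; have [ts|st] := leP (t j) (s j).
  by rewrite max_r ?subr_ge0// subrr addr0.
by rewrite max_l ?subr_le0 ?(ltW st)// sub0r opprB addrC subrK.
Qed.

Variables (A : cstarAlgType R) (X : productSystem Sg A).
Variables (H : hilbertType R) (T : forall s : S, X s -> H -> H).
Arguments T : clear implicits.
Hypothesis T_rep : is_representation T.
Variable Y : forall s : S, interiorTensor (X s) (rep0 T).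
Variable Tt : forall s : S, Y s -> H.
Arguments Tt : clear implicits.
Hypothesis Tt_tilde : forall s : S, is_tilde (T s) (Tt s).
Variable Hh : hilbertSum (hat_component Y).
Variable That : S -> Hh -> Hh.
Hypothesis That_hat : is_hat_semigroup Tt That.
Variables (L : hilbertType R) (i : Hh -> L) (W : S -> L -> L).
Hypothesis W_dil : regular_isometric_dilation That i W.

(** The isometry [W k] is a common factor of [W s] and [W t] and cancels; what remains is the
    regularity of [W] at [f], paired with [b]. *)
Lemma dilation_hip s t k (f : Omega -> R) (hf : in_diff Sg f) a b :
    s = k + pos_part hf -> t = k + neg_part hf ->
  hip (W s (i a)) (W t (i b)) = hip (That (pos_part hf) a) (That (neg_part hf) b).
Proof.
move=> -> ->; have [iI WI [_ WD] reg] := W_dil.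
rewrite -!WD (lin_isometry_hip (WI k)) hipC [RHS]hipC; congr (_^*).
have bW s' := lin_isometry_bounded (WI s').
rewrite -(hip_adjr _ _ (bW _)) -(hip_adjr _ _ (That_bounded That_hat _)).
rewrite -(lin_isometry_hip iI) -reg /oproj /= (lin_isometry_hip iI).
by rewrite (hip_adjr _ _ (lin_isometry_bounded iI)).
Qed.

Definition dil_gen s (x : X s) (h : H) : L := W s (i (fock_ten Hh x h)).

(** Left multiplication by [X u] adds [u] to [s], to [t] and to their minimum, and leaves [s - t]
    unchanged. The same two operators of [That] therefore occur on both sides, and [compatible_That]
    applies. *)
Lemma dil_gen_compatible s t (y : X s) (z : X t) h h' :
  compatible (dil_gen y h) (dil_gen z h')
    (fun u x => dil_gen (ps_mul x y) h) (fun u x => dil_gen (ps_mul x z) h').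
Proof.
have es := min_pos_part s t; have et := min_neg_part s t.
have [c1 c2] := compatible_That T_rep Tt_tilde That_hat y z h h' es et.
have es' u : u + s = (u + fsupp_min s t) + pos_part (sub_in_diff s t).
  by rewrite -addrA -es.
have et' u : u + t = (u + fsupp_min s t) + neg_part (sub_in_diff s t).
  by rewrite -addrA -et.
have es0 : 0 + s = fsupp_min s t + pos_part (sub_in_diff s t) by rewrite add0r.
have et0 : 0 + t = fsupp_min s t + neg_part (sub_in_diff s t) by rewrite add0r.
split=> [u x x'|a]; rewrite /dil_gen (dilation_hip _ _ es et0).
  by rewrite (dilation_hip _ _ (es' u) (et' u)) c1.
by rewrite (dilation_hip _ _ es0 et) c2.
Qed.

Lemma dil_gen_reg (f : Omega -> R) (hf : in_diff Sg f) (x : X (neg_part hf))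
    (y : X (pos_part hf)) h g :
  hip (dil_gen x h) (dil_gen y g) = hip (T _ x h) (T _ y g).
Proof.
rewrite hipC [RHS]hipC; congr (_^*).
rewrite (dilation_hip (k := 0) (hf := hf)) ?add0r//.
rewrite !(That_fock_ten_diag Tt_tilde That_hat).
exact: (lin_isometry_hip (delta0_isom _)).
Qed.

Lemma dil_gen_isom s : lin_isometry (W s \o i).
Proof.
have [[il iI] /(_ s)[Wl WI] _ _] := W_dil.
by split=> [c x y|x] /=; rewrite ?il ?Wl ?WI ?iI.
Qed.

Lemma dil_gen_linear s h : linear (fun x : X s => dil_gen x h).
Proof.
by move=> c x y; rewrite /dil_gen (fock_ten_linear T_rep); exact: (dil_gen_isom s).1.
Qed.

Lemma dil_gen_linearr s (x : X s) : linear (dil_gen x).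
Proof.
move=> c g h; rewrite /dil_gen (fock_ten_linearr T_rep Tt_tilde).
exact: (dil_gen_isom s).1.
Qed.

Lemma dil_gen_norm s (x : X s) h : `|dil_gen x h| <= `|x| * `|h|.
Proof.
rewrite [`|dil_gen x h|](dil_gen_isom s).2 fock_ten_norm// ten_norm//.
exact: rep0_star_hom.
Qed.

Lemma dil_gen_cract s (x : X s) a h : dil_gen (cract x a) h = dil_gen x (rep0 T a h).
Proof.
rewrite /dil_gen; congr (W s (i _)).
apply/eqP; rewrite -subr_eq0; apply/eqP/hip_eq0.
set d := (X in hip X X).
have d0 (y : X s) g : hip (fock_ten Hh y g) d = 0.
  by rewrite /d hipBr !(fock_ten_hip T_rep) ip_ract (star_homM (rep0_star_hom T_rep)) subrr.
by rewrite {1}/d hipBl !d0 subrr.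
Qed.

End Dilation.

(** * The isometric representation *)

Section IsometricRepresentation.
Variables (R : realType) (Omega : Type) (Sg : Omega -> commSubsemigroup R).
Local Notation S := (fsupp Sg).
Implicit Types s t u m n : S.
Variables (A : cstarAlgType R) (X : productSystem Sg A).
Variables (H K : hilbertType R) (G : forall s : S, X s -> H -> K).
Arguments G : clear implicits.

(** [G] abstracts [dil_gen] with its values read in the closed span [K]. *)
Hypothesis G_compatible : forall s t (y : X s) (z : X t) h h',
  compatible (G s y h) (G t z h')
    (fun u x => G _ (ps_mul x y) h) (fun u x => G _ (ps_mul x z) h').
Hypothesis G_total :
  closed_span [set k | exists s (x : X s) h, k = G s x h] = setT.
Hypothesis G_linear : forall s h, linear (fun x : X s => G s x h : K).
Hypothesis G_norm : forall s (x : X s) h, `|G s x h| <= `|x| * `|h|.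

Lemma gen_elt s t (x : X s) (y : X t) h : elt x = elt y -> G s x h = G t y h.
Proof. exact: (elt_fun (fun s x => G s x h)). Qed.

Lemma gen_unit_mul a s (y : X s) h :
  G _ (ps_mul (ps_unit X a) y) h = G s (clact a y) h.
Proof. exact: gen_elt (elt_unit_mul a y). Qed.

Lemma gen_mul_ip u s t (x x' : X u) (y : X s) (z : X t) h h' :
  hip (G _ (ps_mul x y) h) (G _ (ps_mul x' z) h') =
  hip (G s y h) (G t (clact (ip x x') z) h').
Proof. by have [-> _] := G_compatible y z h h'; rewrite gen_unit_mul. Qed.

Lemma gen_clact_ip s t a (y : X s) (z : X t) h h' :
  hip (G s (clact a y) h) (G t z h') = hip (G s y h) (G t (clact (astar a) z) h').
Proof.
by have [_ /(_ a)] := G_compatible y z h h'; rewrite !gen_unit_mul.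
Qed.

Let I := {s : S & (X s * H)%type}.
Let gen (p : I) : K := G (projT1 p) (projT2 p).1 (projT2 p).2.
Let gen_mul u (x : X u) (p : I) : K := G _ (ps_mul x (projT2 p).1) (projT2 p).2.
Let gen_act a (p : I) : K := G (projT1 p) (clact a (projT2 p).1) (projT2 p).2.

Lemma gen_range : range gen = [set k | exists s (x : X s) h, k = G s x h].
Proof.
apply/seteqP; split=> [_ [[s [x h]] _ <-]|_ [s [x [h ->]]]]; first by exists s, x, h.
by exists (existT _ s (x, h)).
Qed.

Let lin_comb_hip (f f' g g' : I -> K) r :
  (forall p q, hip (f p) (f' q) = hip (g p) (g' q)) ->
  hip (lin_comb f r) (lin_comb f' r) = hip (lin_comb g r) (lin_comb g' r).
Proof.
move=> fg; rewrite !hip_suml; apply: eq_bigr => p _.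
rewrite !hip_sumr; apply: eq_bigr => q _.
by rewrite !hipZl !hipZr fg.
Qed.

(** For a combination [v] of generators, [|x v|^2 = <v, <x,x> v>], and [cyclic_vector_bound] gives
    at most [|x|^2 |v|^2]. This bound is what makes left multiplication well defined on [K]. *)
Lemma left_mul_ex u (x : X u) : exists F : K -> K,
  [/\ linear F, forall k, `|F k| <= `|x| * `|k|
    & forall s (y : X s) h, F (G s y h) = G _ (ps_mul x y) h].
Proof.
have [||r|F [Fl Fb FG]] := @bounded_linear_extension _ _ _ _ gen (gen_mul x) `|x|.
- by [].
- by rewrite gen_range.
- rewrite -(@ler_pXn2r _ 2) ?nnegrE ?mulr_ge0// exprMn -hip_norm -ip_norm.
  rewrite (lin_comb_hip (g := gen) (g' := gen_act (ip x x))); last first.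
    by move=> p q; exact: gen_mul_ip.
  apply: (cyclic_vector_bound (w := fun a => lin_comb (gen_act a) r)); last exact: ip_star.
  + move=> c a b; rewrite /lin_comb scaler_sumr -big_split; apply: eq_bigr => p _ /=.
    by rewrite /gen_act clact_linearl G_linear scalerDr !scalerA mulrC.
  + move=> a b; apply: lin_comb_hip => p q.
    by rewrite /gen_act gen_clact_ip clactA.
  + by move=> a; apply: lin_comb_hip => p q; exact: gen_clact_ip.
exists F; split=> // s y h.
exact: (FG (existT _ s (y, h))).
Qed.

Variable V : forall s : S, X s -> K -> K.
Arguments V : clear implicits.
Hypothesis V_linear : forall s (x : X s), linear (V s x).
Hypothesis V_norm : forall s (x : X s) k, `|V s x k| <= `|x| * `|k|.
Hypothesis V_gen : forall u (x : X u) s (y : X s) h,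
  V u x (G s y h) = G _ (ps_mul x y) h.
Local Notation rho := (rep0 V).

Lemma mul_bounded s (x : X s) : bounded_linear (V s x).
Proof. by split; [exact: V_linear | exists `|x|]. Qed.

Lemma rep0_gen a s (y : X s) h : rho a (G s y h) = G s (clact a y) h.
Proof. by rewrite /rep0 V_gen gen_unit_mul. Qed.

Lemma mul_linear s k : linear (fun x : X s => V s x k : K).
Proof.
move=> c x y; move: k; apply: (bounded_linear_eq _ _ G_total).
- exact: mul_bounded.
- by apply: bounded_linear_lin; exact: mul_bounded.
by move=> _ [t [z [h ->]]]; rewrite !V_gen (ps_mul_linearl z) G_linear.
Qed.

Lemma mul_hip s (x y : X s) k l : hip (V s x k) (V s y l) = hip k (rho (ip x y) l).
Proof.
move: l; apply: (hip_eq_total_r G_total) => [||_ [t [z [h ->]]]]; try exact: mul_bounded.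
move: k; apply: (hip_eq_total_l G_total (g := id)) => [||_ [t' [z' [h' ->]]]].
- exact: mul_bounded.
- exact: bounded_linear_id.
by rewrite rep0_gen !V_gen gen_mul_ip.
Qed.

Lemma rho_star_hom : star_hom rho.
Proof.
split.
- move=> a; split; first exact: V_linear.
  by apply: continuous_of_bounded_linear; exact: mul_bounded.
- by move=> c a b h; rewrite /rep0 ps_unit_linear mul_linear.
- move=> a b; apply: (bounded_linear_eq _ _ G_total).
  + exact: mul_bounded.
  + by apply: (@bounded_linear_comp _ _ _ _ (rho b) (rho a)); exact: mul_bounded.
  by move=> _ [t [z [h ->]]]; rewrite !rep0_gen clactA.
move=> a k l; move: l.
apply: (hip_eq_total_r G_total (f := id)) => [||_ [t [z [h ->]]]].
- exact: bounded_linear_id.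
- exact: mul_bounded.
move: k; apply: (hip_eq_total_l G_total (g := id)) => [||_ [t' [z' [h' ->]]]].
- exact: mul_bounded.
- exact: bounded_linear_id.
by rewrite !rep0_gen gen_clact_ip.
Qed.

Lemma mul_mul s t (x : X s) (y : X t) k : V _ (ps_mul x y) k = V s x (V t y k).
Proof.
move: k; apply: (bounded_linear_eq _ _ G_total).
- exact: mul_bounded.
- by apply: (@bounded_linear_comp _ _ _ _ (V t y) (V s x)); exact: mul_bounded.
by move=> _ [u [z [h ->]]]; rewrite !V_gen; apply/gen_elt/elt_mulA.
Qed.

Lemma mul_elt s t (x : X s) (y : X t) k : elt x = elt y -> V s x k = V t y k.
Proof. exact: (elt_fun (fun s x => V s x k)). Qed.

Lemma mul_isometric_representation : is_isometric_representation V.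
Proof.
split; last first.
  move=> s x y k; apply: hip_ext => l.
  by rewrite hip_adjr ?mul_hip//; exact: mul_bounded.
split=> [s|s t x y k]; last exact: mul_mul.
split.
- exact: rho_star_hom.
- split=> [x|c x y h]; last exact: mul_linear.
  by split; [exact: V_linear | apply: continuous_of_bounded_linear; exact: mul_bounded].
- by apply: (isometric_completely_contractive rho_star_hom) => x y h g; exact: mul_hip.
- by move=> x a k; rewrite /rep0 -mul_mul; apply/mul_elt/esym/elt_mul_unit.
by move=> a x k; rewrite /rep0 -mul_mul; apply/mul_elt/esym/elt_unit_mul.
Qed.

(** A generator [G s (clact a y) h] equals [rho a (G s y h)], and [G s x h] is continuous in [x]. *)
Lemma essential_nondegenerate : essential X -> nondegenerate_rep rho.
Proof.
move=> ess; apply: closed_span_total G_total _ => _ [s [x [h ->]]].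
have : closed_span [set v : X s | exists a x, v = clact a x] x by rewrite ess.
move: x; apply: closed_span_ind.
- by rewrite (linear_fun0 (G_linear h)); exact: closed_span0.
- by move=> _ [a [y ->]]; apply: closed_span_mem; exists a, (G s y h); rewrite rep0_gen.
- by move=> c v w hv hw; rewrite G_linear; exact: closed_span_lin.
move=> v hv; apply: closed_span_approx => e e0.
have h1 : 0 < `|h| + 1 by rewrite ltr_wpDl.
have [w Bw vw] := hv _ (divr_gt0 e0 h1); exists (G s w h) => //.
rewrite -(linear_funB _ _ (G_linear h)) (le_lt_trans (G_norm _ _))//.
apply: (@le_lt_trans _ _ (`|v - w| * (`|h| + 1))); first by rewrite ler_wpM2l// lerDl.
by rewrite -ltr_pdivlMr.
Qed.

(** * The inclusion of [H] and the comparison of [V] with [T] *)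

Variable T : forall s : S, X s -> H -> H.
Arguments T : clear implicits.
Hypothesis T_rep : is_representation T.
Hypothesis sigma_nondeg : nondegenerate_rep (rep0 T).
Variable Y : forall s : S, interiorTensor (X s) (rep0 T).
Variable Tt : forall s : S, Y s -> H.
Arguments Tt : clear implicits.
Hypothesis Tt_tilde : forall s : S, is_tilde (T s) (Tt s).
Local Notation sigma := (rep0 T).

Hypothesis G_linearr : forall s (x : X s), linear (G s x).
Hypothesis G_cract : forall s (x : X s) a h, G s (cract x a) h = G s x (sigma a h).
Hypothesis G_reg : forall (f : Omega -> R) (hf : in_diff Sg f) (x : X (neg_part hf))
    (y : X (pos_part hf)) h g,
  hip (G _ x h) (G _ y g) = hip (T _ x h) (T _ y g).

(** Regularity at [f = t - 0], whose positive part is [t] and whose negative part is [0]. *)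
Lemma gen_unit_hip a t (y : X t) h g :
  hip (G 0 (ps_unit X a) h) (G t y g) = hip (sigma a h) (T t y g).
Proof.
have p := min_pos_part t 0; have n := min_neg_part t 0.
have m0 : fsupp_min t 0 = 0.
  by apply: fsupp_ext => j /=; rewrite min_r//; exact: cs_ge0 (fs_in t j).
rewrite m0 !add0r in p n.
(* The membership proof and the unit element are generalized so that the parts of [f] can be
   rewritten inside dependent types. *)
move: (sub_in_diff t 0) p n => hf p n.
rewrite /rep0; move: (ps_unit X a) => x.
have := @G_reg _ hf; rewrite -p -n; exact.
Qed.

Lemma gen_bounded s (x : X s) : bounded_linear (G s x).
Proof. by split; [exact: G_linearr | exists `|x|]. Qed.

Lemma sigma_range :
  range (fun p : A * H => sigma p.1 p.2) = [set v | exists a h, v = sigma a h].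
Proof.
by apply/seteqP; split=> [_ [[a h] _ <-]|_ [a [h ->]]]; [exists a, h | exists (a, h)].
Qed.

(** As [A] may lack a unit, [j] is prescribed on the vectors [sigma a h], which are total because
    [sigma] is nondegenerate. *)
Lemma inclusion_ex : exists j : H -> K,
  lin_isometry j /\ forall a h, j (sigma a h) = G 0 (ps_unit X a) h.
Proof.
have [||j [jI jG]] := @isometry_extension _ H K _ (fun p : A * H => sigma p.1 p.2)
  (fun p => G 0 (ps_unit X p.1) p.2).
- by rewrite sigma_range.
- by move=> p q; rewrite gen_unit_hip.
by exists j; split=> // a h; exact: (jG (a, h)).
Qed.

Variable j : H -> K.
Hypothesis j_isom : lin_isometry j.
Hypothesis j_sigma : forall a h, j (sigma a h) = G 0 (ps_unit X a) h.

Let j_bounded : bounded_linear j := lin_isometry_bounded j_isom.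

Lemma mul_inclusion s (x : X s) h : V s x (j h) = G s x h.
Proof.
move: h; apply: (bounded_linear_eq _ _ sigma_nondeg).
- exact: (bounded_linear_comp j_bounded (mul_bounded x)).
- exact: gen_bounded.
move=> _ [a [h ->]]; rewrite j_sigma V_gen (gen_elt _ (elt_mul_unit x a)).
exact: G_cract.
Qed.

Lemma adj_inclusion_gen t (y : X t) g : adj j (G t y g) = T t y g.
Proof.
apply: hip_ext => h; rewrite hip_adjr//; move: h.
apply: (hip_eq_total_l sigma_nondeg (g := id)) => //; first exact: bounded_linear_id.
by move=> _ [a [h ->]]; rewrite j_sigma gen_unit_hip.
Qed.

Lemma adj_inclusion_bounded : bounded_linear (adj j).
Proof.
apply/contraction_bounded/adj_contraction; split; first exact: j_isom.1.
by move=> x; rewrite j_isom.2.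
Qed.

(** [V] is a coextension of [T]. Hence the projection onto [H] commutes with [rho], and [V s x]
    keeps the complement of [H] inside itself. *)
Lemma adj_inclusion_mul s (x : X s) k : adj j (V s x k) = T s x (adj j k).
Proof.
move: k; apply: (bounded_linear_eq _ _ G_total).
- exact: (bounded_linear_comp (mul_bounded x) adj_inclusion_bounded).
- exact: (bounded_linear_comp adj_inclusion_bounded (rep_bounded T_rep Tt_tilde x)).
move=> _ [t [y [h ->]]]; rewrite V_gen !adj_inclusion_gen.
exact: rep_mul.
Qed.

Lemma rep0_inclusion a h : rho a (j h) = j (sigma a h).
Proof. by rewrite /rep0 mul_inclusion -j_sigma. Qed.

Lemma mul_inclusion_total :
  closed_span [set k | exists s (x : X s) h, k = V s x (j h)] = setT.
Proof.
apply: closed_span_total G_total _ => _ [s [x [h ->]]].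
by apply: closed_span_mem; exists s, x, h; rewrite mul_inclusion.
Qed.

(* As [V s] is isometric, [X s (x)_rho K] is the closed span of the vectors
   [V s x k] in [K], and [Vt s] is the inclusion. *)
Lemma tensor_ex s : exists (Z : interiorTensor (X s) rho) (Vt : Z -> K) (J : Y s -> Z),
  is_tilde (V s) Vt /\
  (lin_isometry J /\ forall x h, J (ten (Y s) x h) = ten Z x (j h)).
Proof.
have [Z [iota [iotaI iota_im iotaT]]] :=
  closed_subspace_ex [set k | exists x k', k = V s x k'].
have /choice [tn htn] : forall p : X s * K, exists z, iota z = V s p.1 p.2.
  by move=> [x k]; apply: iota_im; exists x, k.
have iota_ten x k : iota (tn (x, k)) = V s x k by exact: htn.
have iota_inj := lin_isometry_inj iotaI.
have tnl k : linear (fun x => tn (x, k)).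
  by move=> c x y; apply: iota_inj; rewrite iotaI.1 !iota_ten mul_linear.
have tnr x : linear (fun k => tn (x, k)).
  by move=> c k l; apply: iota_inj; rewrite iotaI.1 !iota_ten V_linear.
have tnip x y k l : hip (tn (x, k)) (tn (y, l)) = hip k (rho (ip x y) l).
  by rewrite -(lin_isometry_hip iotaI) !iota_ten mul_hip.
have tnT : closed_span [set v | exists x k, v = tn (x, k)] = setT.
  apply: closed_span_total iotaT _ => z [x [k zxk]]; apply: closed_span_mem.
  by exists x, k; apply: iota_inj; rewrite iota_ten.
pose Z' := InteriorTensor tnl tnr tnip tnT.
exists Z', iota.
have [||J [JI JG]] := @isometry_extension _ (Y s) Z (X s * H)
  (fun p => ten (Y s) p.1 p.2) (fun p => tn (p.1, j p.2)).
- rewrite -[RHS](ten_dense (Y s)); congr closed_span.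
  by apply/seteqP; split=> [_ [[x h] _ <-]|_ [x [h ->]]]; [exists x, h | exists (x, h)].
- by move=> [x h] [y g] /=; rewrite tnip ten_ip rep0_inclusion (lin_isometry_hip j_isom).
exists J; split; last by split=> // x h; exact: (JG (x, h)).
split; last exact: iota_ten.
by split; [exact: iotaI.1 | move=> z; rewrite iotaI.2].
Qed.

Lemma dilation_regularity : regularity Tt j V.
Proof.
pose YK s := projT1 (cid (tensor_ex s)).
pose Vt s : YK s -> K := projT1 (cid (projT2 (cid (tensor_ex s)))).
pose J s : Y s -> YK s := projT1 (cid (projT2 (cid (projT2 (cid (tensor_ex s)))))).
have hJ s : is_tilde (V s) (@Vt s) /\
    (lin_isometry (@J s) /\ forall x h, J s (ten (Y s) x h) = ten (YK s) x (j h)).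
  exact: (projT2 (cid (projT2 (cid (projT2 (cid (tensor_ex s))))))).
exists YK, Vt, J; split=> [s|s|f hf xi]; [exact: (hJ s).1 | exact: (hJ s).2 |].
have bVt s : bounded_linear (@Vt s) by apply/contraction_bounded; exact: (hJ s).1.1.
have bJ s : bounded_linear (@J s) by apply/lin_isometry_bounded; exact: (hJ s).2.1.
have bTt s : bounded_linear (Tt s) by apply/contraction_bounded; exact: (Tt_tilde s).1.
(* Moving all adjoints across the inner product leaves [<Vt (J eta), Vt (J xi)> = <Tt eta, Tt xi>],
   which on elementary tensors is [G_reg]. *)
rewrite /oproj /=; congr (J _ _); apply: hip_ext => eta.
rewrite (hip_adjr _ _ (bJ _)) (hip_adjr _ _ (bVt _)) (hip_adjr _ _ (bTt _)).
move: xi; apply: (hip_eq_total_r (ten_dense _)) => //.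
  exact: (bounded_linear_comp (bJ _) (bVt _)).
move=> _ [y [g ->]]; move: eta; apply: (hip_eq_total_l (ten_dense _)) => //.
  exact: (bounded_linear_comp (bJ _) (bVt _)).
move=> _ [x [h ->]]; rewrite !(hJ _).2.2 !(hJ _).1.2 !mul_inclusion !(Tt_tilde _).2.
exact: G_reg.
Qed.

Lemma oproj_rep0 a k : oproj j (rho a k) = rho a (oproj j k).
Proof. by rewrite /oproj /= rep0_inclusion -[rho a k]/(V 0 _ k) adj_inclusion_mul. Qed.

Lemma rep0_oproj a k : rho a (oproj j k) = j (sigma a (adj j k)).
Proof. by rewrite /oproj /= rep0_inclusion. Qed.

Lemma mul_orthogonal s (x : X s) k :
  (forall h, hip (j h) k = 0) -> oproj j (V s x k) = 0.
Proof.
move=> jk; rewrite /oproj /= adj_inclusion_mul.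
have -> : adj j k = 0 by apply: hip_ext => h; rewrite hip_adjr// jk hip0r.
have Tl := (rep_bounded T_rep Tt_tilde x).1.
by rewrite (linear_fun0 Tl) (linear_fun0 j_isom.1).
Qed.

Lemma rep0_reduces a : reduces j (rho a).
Proof.
have adja : adj (rho a) = rho (astar a).
  by apply: adj_uniq; have [_ _ _] := rho_star_hom; exact.
by split=> h; rewrite ?adja rep0_inclusion; [exists (sigma a h) | exists (sigma (astar a) h)].
Qed.

End IsometricRepresentation.

(** * Assembly of the dilation of [T] from a dilation of [That] *)

Theorem proposition3p2 (R : realType) (Omega : Type)
    (Sg : Omega -> commSubsemigroup R)
    (A : cstarAlgType R) (X : productSystem Sg A)
    (H : hilbertType R) (T : forall s : fsupp Sg, X s -> H -> H)
    (T_rep : is_representation T)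
    (sigma_nondeg : nondegenerate_rep (rep0 T))
    (Y : forall s : fsupp Sg, interiorTensor (X s) (rep0 T))
    (Tt : forall s : fsupp Sg, Y s -> H)
    (Tt_tilde : forall s : fsupp Sg, is_tilde (T s) (Tt s))
    (Hh : hilbertSum (hat_component Y))
    (That : fsupp Sg -> Hh -> Hh)
    (That_hat : is_hat_semigroup Tt That)
    (That_dil : exists (L : hilbertType R) (i : Hh -> L)
                       (W : fsupp Sg -> L -> L),
                  regular_isometric_dilation That i W) :
  exists (K : hilbertType R) (j : H -> K)
         (V : forall s : fsupp Sg, X s -> K -> K),
    lin_isometry j /\
    is_isometric_representation V /\
    ((forall a k, oproj j (rep0 V a k) = rep0 V a (oproj j k)) /\
     (forall a k, rep0 V a (oproj j k) = j (rep0 T a (adj j k)))) /\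
    regularity Tt j V /\
    closed_span [set k | exists (s : fsupp Sg) (x : X s) (h : H),
                           k = V s x (j h)] = setT /\
    (forall (s : fsupp Sg) (x : X s) (k : K),
       (forall h, hip (j h) k = 0) -> oproj j (V s x k) = 0) /\
    rep_regular_isometric_dilation Tt j V /\
    (nondegenerate_rep (rep0 T) -> essential X -> nondegenerate_rep (rep0 V)).
Proof.
have [L [i [W W_dil]]] := That_dil.
(* [K] is the closed span of the generators in [L]. Each property of [G] below is the one of
   [dil_gen], reflected through the isometry [iota]. *)
have [K [iota [iotaI iota_im iotaT]]] := closed_subspace_ex
  [set l | exists s (x : X s) h, l = dil_gen i W x h].
have /choice [G0 hG0] : forall p : {s : fsupp Sg & (X s * H)%type},
    exists k, iota k = dil_gen i W (projT2 p).1 (projT2 p).2.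
  by move=> [s [x h]]; apply: iota_im; exists s, x, h.
pose G s (x : X s) h := G0 (existT _ s (x, h)).
have iotaG s (x : X s) h : iota (G s x h) = dil_gen i W x h by exact: hG0.
have iota_inj := lin_isometry_inj iotaI.
have G_hip s t (x : X s) (y : X t) h g :
    hip (G s x h) (G t y g) = hip (dil_gen i W x h) (dil_gen i W y g).
  by rewrite -(lin_isometry_hip iotaI) !iotaG.
have G_compatible s t (y : X s) (z : X t) h h' :
    compatible (G s y h) (G t z h')
      (fun u x => G _ (ps_mul x y) h) (fun u x => G _ (ps_mul x z) h').
  have [c1 c2] := dil_gen_compatible T_rep Tt_tilde That_hat W_dil y z h h'.
  by split=> [u x x'|a]; rewrite !G_hip ?c1 ?c2.
have G_total : closed_span [set k | exists s (x : X s) h, k = G s x h] = setT.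
  apply: closed_span_total iotaT _ => k [s [x [h kxh]]]; apply: closed_span_mem.
  by exists s, x, h; apply: iota_inj; rewrite iotaG.
have G_linear s h : linear (fun x : X s => G s x h).
  move=> c x y; apply: iota_inj.
  by rewrite iotaI.1 !iotaG (dil_gen_linear T_rep W_dil).
have G_linearr s (x : X s) : linear (G s x).
  move=> c h g; apply: iota_inj.
  by rewrite iotaI.1 !iotaG (dil_gen_linearr T_rep Tt_tilde W_dil).
have G_norm s (x : X s) h : `|G s x h| <= `|x| * `|h|.
  by rewrite -(iotaI.2 (G s x h)) iotaG; exact: (dil_gen_norm T_rep W_dil).
have G_cract s (x : X s) a h : G s (cract x a) h = G s x (rep0 T a h).
  by apply: iota_inj; rewrite !iotaG; exact: (dil_gen_cract T_rep).
have G_reg (f : Omega -> R) (hf : in_diff Sg f) (x : X (neg_part hf))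
    (y : X (pos_part hf)) h g : hip (G _ x h) (G _ y g) = hip (T _ x h) (T _ y g).
  by rewrite G_hip; exact: (dil_gen_reg Tt_tilde That_hat W_dil).
(* Indexing by the disjoint union lets one choice produce [V] on all fibres. *)
have V_ex (p : {u : fsupp Sg & (X u : Type)}) :=
  left_mul_ex G_compatible G_total G_linear (projT2 p).
have [V0 hV0] := choice V_ex.
pose V u (x : X u) := V0 (existT _ u x).
have V_linear u (x : X u) : linear (V u x) by have [] := hV0 (existT _ u x).
have V_norm u (x : X u) k : `|V u x k| <= `|x| * `|k|.
  by have [_ + _] := hV0 (existT _ u x); exact.
have V_gen u (x : X u) s (y : X s) h : V u x (G s y h) = G _ (ps_mul x y) h.
  by have [_ _ +] := hV0 (existT _ u x); exact.
have [j [j_isom j_sigma]] := inclusion_ex sigma_nondeg G_reg.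
have V_iso := mul_isometric_representation G_compatible G_total G_linear
  V_linear V_norm V_gen.
exists K, j, V.
split; first exact: j_isom.
split; first exact: V_iso.
split.
  by split=> a k; [apply: oproj_rep0 | apply: rep0_oproj]; eassumption.
have V_reg : regularity Tt j V by apply: dilation_regularity; eassumption.
split; first exact: V_reg.
split; first by apply: mul_inclusion_total; eassumption.
split; first by move=> s x k; apply: mul_orthogonal; eassumption.
split; last by move=> _; apply: essential_nondegenerate; eassumption.
split=> // a; split; first by apply: rep0_reduces; eassumption.
by move=> h; apply: rep0_inclusion; eassumption.
Qed.
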